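(* Let $B$ be a finite Blaschke product with at least one zero, let $M_1=\overline{\mathrm{span}\{B^t : t\in\mathbb{Z}\}}^{L^2(\mathbb{T})}$, let $\phi=\sum_{n\in\mathbb{Z}}a_nB^n\in M_1$, and denote $\varphi(z)=\sum_{n\in\mathbb{Z}}a_nz^n\in L^2(\mathbb{T})$. Then $T_\phi$ is distributed as $|\varphi|$ in the sense of the singular values relative to the sequence of model spaces $(K_{B^n})_{n\in\mathbb{N}}$. If moreover $\phi$ is real valued, then $T_\phi$ is distributed as $\varphi$ in the sense of the eigenvalues relative to the sequence of model spaces $(K_{B^n})_{n\in\mathbb{N}}$.
   Context: $\mathbb{T}$ is the unit circle, $\mathbb{D}$ the open unit disc, $L^2(\mathbb{T})$ has inner product $\langle f,g\rangle=\int_{\mathbb{T}}f\overline{g}\,\frac{d\xi}{2\pi}$ ($d\xi$ is arc length), and $H^2=\{f\in L^2(\mathbb{T}):\hat f(n)=0\text{ for }n<0\}$ is the Hardy space. For $\lambda\in\mathbb{D}$, $b_\lambda(z)=\frac{z-\lambda}{1-\overline{\lambda}z}$. A finite Blaschke product with zeros $\lambda_1,\dots,\lambda_m\in\mathbb{D}$ (repeated according to multiplicity, $m\ge 1$) is $B=\prod_{i=1}^m b_{\lambda_i}$. Its negative powers are taken on $\mathbb{T}$, where $|B|=1$. Every $\phi\in M_1$ can be written as an $L^2(\mathbb{T})$-convergent series $\phi=\sum_{n\in\mathbb{Z}}a_nB^n$ with $(a_n)\in\ell^2(\mathbb{Z})$. For an inner function $\theta$, the model space is $K_\theta=H^2\ominus\theta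 H^2$. When $\theta$ is a finite Blaschke product, $K_\theta$ is finite dimensional and consists of bounded functions; for $f\in L^2(\mathbb{T})$, $T_{f,K_\theta}:K_\theta\to K_\theta$ is the operator $T_{f,K_\theta}(g)=P_{K_\theta}(fg)$, where $P_{K_\theta}$ is the orthogonal projection onto $K_\theta$ (the compression to $K_\theta$ of the Toeplitz operator $T_f$). Let $g$ be a measurable function on $\mathbb{T}$. $T_f$ is said to be distributed as $g$ in the sense of the eigenvalues (respectively, of the singular values) relative to $(K_{B^n})_{n\in\mathbb{N}}$ if for every continuous function $G$ with compact support $$\lim_{n\to\infty}\frac{1}{\dim K_{B^n}}\sum_{k=1}^{\dim K_{B^n}}G(s_k(T_{f,K_{B^n}}))=\frac{1}{2\pi}\int_{\mathbb{T}}G(g(\xi))\,d\xi,$$ where $(s_k(A))_k$ denotes the eigenvalues $\lambda_k(A)$ of $A$ (respectively, the singular values $\sigma_k(A)$ of $A$), counted with multiplicity. *)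

(* Defs.v *)
From HB Require Import structures.
From mathcomp Require Import all_boot all_order all_algebra.
From mathcomp Require Import complex.
From mathcomp Require Import all_classical all_reals all_analysis.

Set Implicit Arguments.
Unset Strict Implicit.
Unset Printing Implicit Defensive.

Import Order.TTheory GRing.Theory Num.Theory numFieldNormedType.Exports.

Local Open Scope classical_set_scope.
Local Open Scope ring_scope.
Local Open Scope complex_scope.

(* A function on the unit circle is represented by a function R[i] -> R[i], of
   which only the values on the circle matter. An element of L^2 of the circle
   is such a representative, and equality in L^2 is [ae_circle]-equality. *)

Definition circle_pt (R : realType) (t : R) : R[i] := cos t +i* sin t.

Definition ae_circle (R : realType) (P : R[i] -> Prop) : Prop :=
  {ae lebesgue_measure,
    forall t : R, t \in `[0, 2 * pi]%R -> P (circle_pt t)}.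

(* (1 / 2 pi) times the integral over the circle with respect to arc length *)
Definition circle_mean (R : realType) (f : R[i] -> R[i]) : R[i] :=
  ((2 * pi)^-1 *
     \int[lebesgue_measure]_(t in `[0, 2 * pi]) complex.Re (f (circle_pt t)))
  +i*
  ((2 * pi)^-1 *
     \int[lebesgue_measure]_(t in `[0, 2 * pi]) complex.Im (f (circle_pt t))).

Definition L2 (R : realType) : set (R[i] -> R[i]) :=
  [set f : R[i] -> R[i] | [/\ measurable_fun `[0, 2 * pi]
                 (fun t : R => complex.Re (f (circle_pt t))),
               measurable_fun `[0, 2 * pi]
                 (fun t : R => complex.Im (f (circle_pt t))) &
               (\int[lebesgue_measure]_(t in `[0%R, (2 * pi)%R])
                  ((complex.Re `|f (circle_pt t)| ^+ 2)%:E) < +oo)%E]].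

Definition inner (R : realType) (f g : R[i] -> R[i]) : R[i] :=
  circle_mean (fun z => f z * (g z)^*).

Definition L2norm (R : realType) (f : R[i] -> R[i]) : R :=
  Num.sqrt (complex.Re (inner f f)).

Definition L2_series (R : realType) (u : int -> R[i] -> R[i])
    (f : R[i] -> R[i]) : Prop :=
  (fun N : nat => L2norm (fun z =>
     f z - \sum_(0 <= k < N.*2.+1) u (k%:Z - N%:Z) z)) @ \oo --> (0 : R).

Definition fourier (R : realType) (f : R[i] -> R[i]) (n : int) : R[i] :=
  inner f (fun z => z ^ n).

Definition Hardy2 (R : realType) : set (R[i] -> R[i]) :=
  [set f : R[i] -> R[i] | L2 f /\ forall n : int, n < 0 -> fourier f n = 0].

(* K_theta, the orthogonal complement of theta H^2 in H^2 *)
Definition model_space (R : realType) (theta : R[i] -> R[i]) :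
    set (R[i] -> R[i]) :=
  [set f : R[i] -> R[i] | Hardy2 f /\
     forall h, Hardy2 h -> inner f (fun z => theta z * h z) = 0].

Definition blaschke (R : realType) (m : nat) (lam : 'I_m -> R[i]) :
    R[i] -> R[i] :=
  fun z => \prod_(i < m) ((z - lam i) / (1 - (lam i)^* * z)).

(* L^2-closure of the span of the integer powers of B *)
Definition M1 (R : realType) (B : R[i] -> R[i]) : set (R[i] -> R[i]) :=
  [set f : R[i] -> R[i] | L2 f /\
     forall eps : R, 0 < eps ->
       exists (r : seq int) (c : int -> R[i]),
         L2norm (fun z => f z - \sum_(t <- r) c t * B z ^ t) < eps].

(* Below, K is a subspace of L^2 and T an operator on K. The operators are made
   total by classical choice; [xget x0 A] is an element of A if A is nonempty. *)

Definition is_basis (R : realType) (K : set (R[i] -> R[i])) (N : nat)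
    (e : 'I_N -> R[i] -> R[i]) : Prop :=
  [/\ forall i, K (e i),
      forall c : 'I_N -> R[i],
        ae_circle (fun z => \sum_(i < N) c i * e i z = 0) ->
        forall i, c i = 0 &
      forall f, K f -> exists c : 'I_N -> R[i],
        ae_circle (fun z => f z = \sum_(i < N) c i * e i z)].

Definition subspace_dim (R : realType) (K : set (R[i] -> R[i])) : nat :=
  xget 0%N [set N | exists e : 'I_N -> R[i] -> R[i], is_basis K e].

Definition proj (R : realType) (K : set (R[i] -> R[i])) (f : R[i] -> R[i]) :
    R[i] -> R[i] :=
  xget (fun=> 0)
    [set p : R[i] -> R[i] | K p /\ forall k, K k -> inner (fun z => f z - p z) k = 0].

Definition toeplitz (R : realType) (f : R[i] -> R[i])
    (K : set (R[i] -> R[i])) (g : R[i] -> R[i]) : R[i] -> R[i] :=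
  proj K (fun z => f z * g z).

Definition adjoint (R : realType) (K : set (R[i] -> R[i]))
    (T : (R[i] -> R[i]) -> R[i] -> R[i]) (h : R[i] -> R[i]) : R[i] -> R[i] :=
  xget (fun=> 0)
    [set p : R[i] -> R[i] | K p /\ forall g, K g -> inner (T g) h = inner g p].

(* s lists the roots, with multiplicity, of the characteristic polynomial of the
   matrix A of T in some basis e of K. *)
Definition is_eigenvalues (R : realType) (K : set (R[i] -> R[i]))
    (T : (R[i] -> R[i]) -> R[i] -> R[i]) (s : seq R[i]) : Prop :=
  exists (N : nat) (e : 'I_N -> R[i] -> R[i]) (A : 'M[R[i]]_N),
    [/\ is_basis K e,
        forall j, ae_circle (fun z => T (e j) z = \sum_(i < N) A i j * e i z) &
        char_poly A = \prod_(x <- s) ('X - x%:P)].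

Definition eigenvalues (R : realType) (K : set (R[i] -> R[i]))
    (T : (R[i] -> R[i]) -> R[i] -> R[i]) : seq R[i] :=
  xget [::] [set s | is_eigenvalues K T s].

Definition singular_values (R : realType) (K : set (R[i] -> R[i]))
    (T : (R[i] -> R[i]) -> R[i] -> R[i]) : seq R[i] :=
  [seq sqrtC x | x <- eigenvalues K (adjoint K T \o T)].

(* The topology of R[i] is carried by its alias R[i]^o. The test functions G are
   complex valued and defined on the complex plane; real (singular) values are
   seen in it. *)
Definition distributed (R : realType) (K : nat -> set (R[i] -> R[i]))
    (s : nat -> seq R[i]) (g : R[i] -> R[i]) : Prop :=
  forall G : R[i]^o -> R[i]^o,
    continuous G -> compact (closure [set z : R[i]^o | G z != 0]) ->
    (fun n : nat => ((subspace_dim (K n))%:R^-1 *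
        \sum_(k < subspace_dim (K n)) G (s n)`_k : R[i]^o)) @ \oo -->
      (circle_mean (G \o g) : R[i]^o).

Definition distributed_eigenvalues (R : realType) (f : R[i] -> R[i])
    (K : nat -> set (R[i] -> R[i])) (g : R[i] -> R[i]) : Prop :=
  distributed K (fun n => eigenvalues (K n) (toeplitz f (K n))) g.

Definition distributed_singular_values (R : realType) (f : R[i] -> R[i])
    (K : nat -> set (R[i] -> R[i])) (g : R[i] -> R[i]) : Prop :=
  distributed K (fun n => singular_values (K n) (toeplitz f (K n))) g.

(* Main.v *)
(* The Takenaka-Malmquist system of the zeros of B, repeated with period m, is an
   orthonormal basis of K_(B^n), in which T_phi has the matrix with entries
   a_(k-l) delta_(r,s), an n x n Toeplitz matrix A tensored with the identity of
   size m. For |z| = 1 the vector v(z) with entries z^(-k) / sqrt n is an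
   approximate eigenvector of A for the value varphi(z): the mean over the circle
   of |A v(z) - varphi(z) v(z)|^2 is 1/n times the sum over k < n of the squared
   distances in L^2 from varphi to windows of its Fourier series, hence tends
   to 0. The spectral weights of v(z) (of A, or of A^* A for the singular values)
   thus concentrate at varphi(z) in quadratic mean, while the weight of each
   eigenvector has mean 1/n. Averaging G(d_i) - G(varphi(z)) against these weights
   compares the mean of G over the spectrum with its mean along the symbol; uniform
   continuity |G x - G y| <= eps + K |x - y|^2 gives the limit. *)
Require Import Defs.
From HB Require Import structures.
From mathcomp Require Import all_boot all_order all_algebra.
From mathcomp Require Import complex.
From mathcomp Require Import ring lra zify.
From mathcomp Require Import all_classical all_reals all_analysis.
From mathcomp Require Import measurable_realfun spectral.
Import Order.TTheory GRing.Theory Num.Theory numFieldNormedType.Exports.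
Local Open Scope classical_set_scope.
Local Open Scope ring_scope.

Set Implicit Arguments.
Unset Strict Implicit.
Unset Printing Implicit Defensive.

(** The obstacle is that the symbol is only square integrable: in general neither [varphi] nor the
    norms of the matrices A are bounded. With y = varphi(z) one has A^* A v - |y|^2 v = y (A^* v -
    y^* v) + A^* (A v - y v), and both y and A^* may be large, so the squared singular values cannot
    be compared with |y|^2 directly. In singular coordinates the two large factors are y and s_i,
    and the factor s_i + |y| of s_i^2 - |y|^2 absorbs both; this is why the estimate bears on the
    singular values themselves and uses the defects of A and of A^*. For the same reason z runs over
    the whole circle and not over roots of unity: the mean over z gives the integral of G along
    [varphi] exactly, whereas a Riemann sum would require regularity of the symbol. A second
    difficulty is that projections, adjoints and lists of eigenvalues are choices among
    representatives. Operators are therefore tied to matrices up to almost everywhere equality, and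
    spectra are known up to permutation, which is enough for symmetric sums. *)

(** * Measurability of complex functions on the circle *)

Section CircleMeasurability.
Context {R : realType}.
Local Notation C := R[i].
Local Notation mu := (@lebesgue_measure R).
Local Notation D := (`[0, 2 * pi]%classic : set R).
Implicit Types (f g h : C -> C) (c : C).

Definition circle_measurable f :=
  measurable_fun D (fun t : R => complex.Re (f (circle_pt t))) /\
  measurable_fun D (fun t : R => complex.Im (f (circle_pt t))).

Definition circle_integrable f :=
  mu.-integrable D (EFin \o (fun t : R => complex.Re (f (circle_pt t)))) /\
  mu.-integrable D (EFin \o (fun t : R => complex.Im (f (circle_pt t)))).

Lemma ReD (x y : C) : complex.Re (x + y) = complex.Re x + complex.Re y.
Proof. by case: x y => [? ?] [? ?]. Qed.
Lemma ImD (x y : C) : complex.Im (x + y) = complex.Im x + complex.Im y.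
Proof. by case: x y => [? ?] [? ?]. Qed.
Lemma ReM (x y : C) : complex.Re (x * y) =
  complex.Re x * complex.Re y - complex.Im x * complex.Im y.
Proof. by case: x y => [? ?] [? ?]. Qed.
Lemma ImM (x y : C) : complex.Im (x * y) =
  complex.Re x * complex.Im y + complex.Im x * complex.Re y.
Proof. by case: x y => [? ?] [? ?]. Qed.
Lemma conjCE (x : C) : x^* = (complex.Re x -i* complex.Im x)%C.
Proof. by case: x. Qed.
Lemma normCE (x : C) :
  `|x| = (Num.sqrt (complex.Re x ^+ 2 + complex.Im x ^+ 2))%:C%C.
Proof. by case: x. Qed.
Lemma complex_leE (x y : C) :
  (x <= y) = (complex.Im y == complex.Im x) && (complex.Re x <= complex.Re y).
Proof. by rewrite lecE. Qed.
Lemma complex_eqP (x y : C) :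
  complex.Re x = complex.Re y -> complex.Im x = complex.Im y -> x = y.
Proof. by case: x y => [? ?] [? ?] /= -> ->. Qed.
Lemma Re_le_norm (x : C) : `|complex.Re x| <= complex.Re `|x|.
Proof. by have := normc_ge_Re x; rewrite complex_leE => /andP[]. Qed.
Lemma Im_le_norm (x : C) : `|complex.Im x| <= complex.Re `|x|.
Proof.
by rewrite normCE /= -sqrtr_sqr ler_wsqrtr // lerDr sqr_ge0.
Qed.
Lemma Re_norm (x : C) : (complex.Re `|x|)%:C%C = `|x|.
Proof. by rewrite normCE. Qed.
Lemma norm_le_ReIm (x : C) :
  complex.Re `|x| <= `|complex.Re x| + `|complex.Im x|.
Proof.
rewrite normCE /= -[leRHS]ger0_norm ?addr_ge0 // -sqrtr_sqr ler_wsqrtr //.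
by rewrite sqrrD !real_normK ?num_real // -addrA addrCA addrC lerDl
  mulrn_wge0 // mulr_ge0.
Qed.

Lemma measurable_fun_eq1 (E : set R) (u v : R -> R) :
  v =1 u -> measurable_fun E u -> measurable_fun E v.
Proof. by move=> /funext ->. Qed.

Lemma measurable_D : measurable (D : set (measurableTypeR R)).
Proof. exact: measurable_itv. Qed.

Lemma circle_measurable_cst c : circle_measurable (fun=> c).
Proof. by split; exact: measurable_cst. Qed.

Lemma circle_measurable_id : circle_measurable id.
Proof.
by split => /=; apply: measurable_funTS; apply: continuous_measurable_fun => x;
  [exact: continuous_cos|exact: continuous_sin].
Qed.

Lemma circle_measurableD f g :
  circle_measurable f -> circle_measurable g ->
  circle_measurable (fun z => f z + g z).
Proof.
move=> [f1 f2] [g1 g2]; split.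
- apply: (measurable_fun_eq1 (fun t => ReD (f _) (g _))).
  exact: measurable_funD.
- apply: (measurable_fun_eq1 (fun t => ImD (f _) (g _))).
  exact: measurable_funD.
Qed.

Lemma circle_measurableM f g :
  circle_measurable f -> circle_measurable g ->
  circle_measurable (fun z => f z * g z).
Proof.
move=> [f1 f2] [g1 g2]; split.
- apply: (measurable_fun_eq1 (fun t => ReM (f _) (g _))).
  by apply: measurable_funB; exact: measurable_funM.
- apply: (measurable_fun_eq1 (fun t => ImM (f _) (g _))).
  by apply: measurable_funD; exact: measurable_funM.
Qed.

Lemma circle_measurable_conj f :
  circle_measurable f -> circle_measurable (fun z => (f z)^*).
Proof.
move=> [f1 f2]; split.
- by apply: measurable_fun_eq1 f1 => t; rewrite conjCE.
- by apply: measurable_fun_eq1 (measurable_funN f2) => t; rewrite conjCE.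
Qed.

Lemma eq_circle_measurable f g :
  (forall t, f (circle_pt t) = g (circle_pt t)) ->
  circle_measurable f -> circle_measurable g.
Proof.
by move=> fg [f1 f2]; split; [apply: measurable_fun_eq1 f1|
  apply: measurable_fun_eq1 f2] => t; rewrite fg.
Qed.

(** The inverse is the conjugate divided by the squared modulus, and the real inverse is taken as
    the measurable power with exponent -1; the two agree at 0 as well, where both are 0. *)
Lemma circle_measurableV f :
  circle_measurable f -> circle_measurable (fun z => (f z)^-1).
Proof.
move=> mf; have [f1 f2] := mf.
pose n2 z : R := complex.Re (f z) ^+ 2 + complex.Im (f z) ^+ 2.
apply: (@eq_circle_measurable (fun z => (f z)^* * ((n2 z) `^ (-1))%:C%C)).
  move=> t; rewrite powR_inv1 ?addr_ge0 ?sqr_ge0 // /n2.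
  rewrite [RHS]invC_norm mulrC; congr (_ * _).
  by rewrite -exprVn exprVn normCE -rmorphXn /= sqr_sqrtr ?addr_ge0 ?sqr_ge0 // fmorphV.
apply: circle_measurableM; first exact: circle_measurable_conj.
split => /=; last exact: measurable_cst.
apply: (measurableT_comp (measurable_powR _)).
by apply: measurable_funD; exact: measurable_funX.
Qed.

(** An open set of the plane is the union of the countably many squares [box i] that it contains,
    with rational centres and half-sides 1/(k+1); the preimage of a square is the intersection of
    the preimages of two intervals. This makes compositions with continuous functions of the plane
    measurable. *)
Lemma circle_measurable_open f (W : set C^o) :
  circle_measurable f -> open W -> measurable (D `&` [set t | W (f (circle_pt t))]).
Proof.
move=> [f1 f2] oW.
pose box (i : rat * rat * nat) : set C :=
  [set w | `|complex.Re w - ratr i.1.1| < i.2.+1%:R^-1 /\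
           `|complex.Im w - ratr i.1.2| < i.2.+1%:R^-1].
have mbox i : measurable (D `&` [set t | box i (f (circle_pt t))]).
  rewrite [X in measurable X](_ : _ =
    (D `&` (fun t : R => complex.Re (f (circle_pt t))) @^-1`
       (ball (ratr i.1.1 : R) i.2.+1%:R^-1)) `&`
    (D `&` (fun t : R => complex.Im (f (circle_pt t))) @^-1`
       (ball (ratr i.1.2 : R) i.2.+1%:R^-1))).
    by apply: measurableI; [apply: f1|apply: f2] => //; exact: measurable_ball.
  apply/seteqP; rewrite /box /ball /= /ball_ /=; split => t /=.
    by rewrite ![`|_ (f _) - _|]distrC => -[Dt [? ?]].
  by rewrite ![`|_ - _ (f _)|]distrC => -[[Dt ?] [_ ?]].
rewrite (_ : _ `&` _ = \bigcup_(i in [set i | box i `<=` W])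
    (D `&` [set t | box i (f (circle_pt t))])); last first.
  apply/seteqP; split => t /=; last by move=> [i /= iW [Dt]] /iW.
  move=> [Dt Wt]; set w := f (circle_pt t) in Wt *.
  have /nbhs_ballP[e /= e0 eW] : nbhs (w : C^o) W by move: oW; rewrite openE; apply.
  have [e1 He] : exists e1 : R, e = e1%:C%C.
    by apply/complex_realP; exact: gtr0_real.
  have e10 : 0 < e1 by rewrite -ltcR -He.
  (* Two points of a square differ by less than 2/(k+1) in each coordinate; with 1/(k+1) < e1/4 the
     two coordinates together contribute less than e1. *)
  pose k := Num.truncn (4 * e1^-1).
  have hk : (k.+1%:R)^-1 < e1 / 4.
    rewrite -[e1 / 4]invrK invf_div ltf_pV2 ?posrE ?ltr0n ?divr_gt0 //.
    by rewrite truncnS_gt.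
  have hq (x : R) : exists q : rat, `|x - ratr q| < k.+1%:R^-1.
    have [|q] := @rat_in_itvoo R (x - k.+1%:R^-1) (x + k.+1%:R^-1).
      by rewrite ltrBlDr -addrA ltrDl addr_gt0 // invr_gt0 ltr0n.
    by rewrite in_itv /= => qx; exists q; rewrite distrC ltr_distl.
  have [q1 hq1] := hq (complex.Re w); have [q2 hq2] := hq (complex.Im w).
  exists (q1, q2, k) => //= w' /= [h1 h2]; apply: eW.
  rewrite /ball /= He normCE ltcR.
  have := norm_le_ReIm (w - w'); rewrite normCE /= => /le_lt_trans; apply.
  rewrite ReD ImD !raddfN /=.
  have h3 : `|complex.Re w - complex.Re w'| < e1 / 2.
    rewrite -(subrKA (ratr q1)) (le_lt_trans (ler_normD _ _)) //.
    have : `|complex.Re w' - ratr q1| < k.+1%:R^-1 := h1.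
    rewrite [`|ratr _ - _|]distrC; move: (k.+1%:R^-1) hk hq1 {h1 h2 hq hq2}.
    by move=> dl *; lra.
  have h4 : `|complex.Im w - complex.Im w'| < e1 / 2.
    rewrite -(subrKA (ratr q2)) (le_lt_trans (ler_normD _ _)) //.
    have : `|complex.Im w' - ratr q2| < k.+1%:R^-1 := h2.
    rewrite [`|ratr _ - _|]distrC; move: (k.+1%:R^-1) hk hq2 {h1 h2 hq hq1}.
    by move=> dl *; lra.
  by move: h3 h4; lra.
rewrite bigcup_mkcond; apply: countable_bigcupT_measurable => // i.
by case: ifP.
Qed.

Lemma continuous_Re : continuous (@complex.Re R : C^o -> R).
Proof.
move=> w; apply: (fun u => (cvgrPdist_lt (F := nbhs (w : C^o)) _ _).2 u) => e e0.
have : \forall w' \near (w : C^o), `|w - w'| < e%:C%C.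
  apply: (@cvgr_dist_lt _ C^o _ (nbhs (w : C^o)) _ id w); first exact: cvg_id.
  by rewrite -[0]/((0 : R)%:C%C) ltcR.
apply: filterS => w'; rewrite normCE ltcR; apply: le_lt_trans.
have := Re_le_norm (w - w'); rewrite normCE /=; apply: le_trans.
by rewrite ReD raddfN.
Qed.

Lemma continuous_Im : continuous (@complex.Im R : C^o -> R).
Proof.
move=> w; apply: (fun u => (cvgrPdist_lt (F := nbhs (w : C^o)) _ _).2 u) => e e0.
have : \forall w' \near (w : C^o), `|w - w'| < e%:C%C.
  apply: (@cvgr_dist_lt _ C^o _ (nbhs (w : C^o)) _ id w); first exact: cvg_id.
  by rewrite -[0]/((0 : R)%:C%C) ltcR.
apply: filterS => w'; rewrite normCE ltcR; apply: le_lt_trans.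
have := Im_le_norm (w - w'); rewrite normCE /=; apply: le_trans.
by rewrite ImD raddfN.
Qed.

Lemma circle_measurable_comp f (G : C^o -> C^o) :
  circle_measurable f -> continuous G -> circle_measurable (fun z => G (f z)).
Proof.
move=> mf cG; suff H (p : C^o -> R) : continuous p ->
    measurable_fun D (fun t => p (G (f (circle_pt t)))).
  by split; apply: H; [exact: continuous_Re|exact: continuous_Im].
move=> cp; apply: (measurability _ (RGenOpens.measurableE R)).
move=> _ [_ [a [b ->] <-]].
apply: (@circle_measurable_open f [set w | p (G w) \in `]a, b[]) => //.
move/continuousP : cp => /(_ `]a, b[%classic) oc.
move/continuousP : cG => /(_ (p @^-1` `]a, b[%classic)); apply.
by apply: oc; exact: interval_open.
Qed.

End CircleMeasurability.

(** * Integrability and the mean over the circle *)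

Section CircleMean.
Context {R : realType}.
Local Notation C := R[i].
Local Notation mu := (@lebesgue_measure R).
Local Notation D := (`[0, 2 * pi]%classic : set R).
Implicit Types (f g h : C -> C) (c : C).

Lemma integrable_eq1 (u v : R -> R) :
  v =1 u -> mu.-integrable D (EFin \o u) -> mu.-integrable D (EFin \o v).
Proof. by move=> /funext ->. Qed.

Lemma circle_integrable_measurable f :
  circle_integrable f -> circle_measurable f.
Proof.
by move=> [/integrableP[/measurable_EFinP f1 _] /integrableP[/measurable_EFinP f2 _]].
Qed.

Lemma circle_integrableD f g : circle_integrable f -> circle_integrable g ->
  circle_integrable (fun z => f z + g z).
Proof.
move=> [f1 f2] [g1 g2]; split.
- apply: (integrable_eq1 (fun t => ReD (f _) (g _))).
  exact: (integrableD measurable_D f1 g1).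
- apply: (integrable_eq1 (fun t => ImD (f _) (g _))).
  exact: (integrableD measurable_D f2 g2).
Qed.

Lemma circle_integrableZ c f : circle_integrable f ->
  circle_integrable (fun z => c * f z).
Proof.
move=> [f1 f2]; split.
- apply: (integrable_eq1 (fun t => ReM c (f _))).
  exact: (integrableB measurable_D (integrableZl measurable_D _ f1)
           (integrableZl measurable_D _ f2)).
- apply: (integrable_eq1 (fun t => ImM c (f _))).
  exact: (integrableD measurable_D (integrableZl measurable_D _ f2)
           (integrableZl measurable_D _ f1)).
Qed.

Lemma circle_integrable_conj f : circle_integrable f ->
  circle_integrable (fun z => (f z)^*).
Proof.
move=> [f1 f2]; split.
- by apply: integrable_eq1 f1 => t; rewrite conjCE.
- apply: (@integrable_eq1 (fun t => - complex.Im (f (circle_pt t)))).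
    by move=> t; rewrite conjCE.
  exact: (integrable_eq1 (fun t => esym (mulN1r _)) (integrableZl measurable_D (-1) f2)).
Qed.

Lemma eq_circle_integrable f g : (forall t, f (circle_pt t) = g (circle_pt t)) ->
  circle_integrable f -> circle_integrable g.
Proof.
by move=> fg [f1 f2]; split; [apply: integrable_eq1 f1|
  apply: integrable_eq1 f2] => t; rewrite fg.
Qed.

Lemma mu_D_fin : (mu D < +oo)%E.
Proof. by rewrite lebesgue_measure_itv /=; case: ifP => // _; rewrite -EFinD ltry. Qed.

Lemma le_circle_integrable f h : circle_measurable f -> circle_integrable h ->
  (forall t, `|f (circle_pt t)| <= h (circle_pt t)) -> circle_integrable f.
Proof.
move=> [f1 f2] [h1 h2] fh.
have fhR t : complex.Re `|f (circle_pt t)| <= complex.Re (h (circle_pt t)).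
  by have := fh t; rewrite complex_leE => /andP[].
split; apply: (le_integrable measurable_D _ _ h1) => /=.
- exact/measurable_EFinP.
- move=> t _; rewrite lee_fin; apply: le_trans (Re_le_norm _) _.
  by apply: le_trans (fhR t) _; exact: ler_norm.
- exact/measurable_EFinP.
- move=> t _; rewrite lee_fin; apply: le_trans (Im_le_norm _) _.
  by apply: le_trans (fhR t) _; exact: ler_norm.
Qed.

Lemma circle_integrable_cst c : circle_integrable (fun=> c).
Proof.
by split; apply: measurable_bounded_integrable => //; [exact: mu_D_fin| |
  exact: mu_D_fin|]; exists (`|complex.Re c| + `|complex.Im c|)%R; split;
  rewrite ?num_real // => x cx y _ /=; apply: le_trans (ltW cx);
  rewrite ?lerDl ?lerDr.
Qed.

Lemma circle_integrable_bounded f (M : C) : circle_measurable f ->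
  (forall t, `|f (circle_pt t)| <= M) -> circle_integrable f.
Proof. by move=> mf; apply: le_circle_integrable mf (circle_integrable_cst _). Qed.

Lemma Re_circle_mean f : complex.Re (circle_mean f) =
  (2 * pi)^-1 * \int[mu]_(t in D) complex.Re (f (circle_pt t)).
Proof. by []. Qed.
Lemma Im_circle_mean f : complex.Im (circle_mean f) =
  (2 * pi)^-1 * \int[mu]_(t in D) complex.Im (f (circle_pt t)).
Proof. by []. Qed.

Lemma eq_circle_mean f g : (forall t, f (circle_pt t) = g (circle_pt t)) ->
  circle_mean f = circle_mean g.
Proof.
by move=> fg; rewrite /circle_mean; congr (_ * _ +i* (_ * _))%C;
  apply: eq_Rintegral => t _; rewrite fg.
Qed.

Lemma circle_meanD f g : circle_integrable f -> circle_integrable g ->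
  circle_mean (fun z => f z + g z) = circle_mean f + circle_mean g.
Proof.
move=> [f1 f2] [g1 g2]; apply: complex_eqP.
- rewrite ReD !Re_circle_mean -mulrDr -(RintegralD measurable_D f1 g1).
  by congr (_ * _); apply: eq_Rintegral => t _; rewrite ReD.
- rewrite ImD !Im_circle_mean -mulrDr -(RintegralD measurable_D f2 g2).
  by congr (_ * _); apply: eq_Rintegral => t _; rewrite ImD.
Qed.

Lemma circle_meanZ c f : circle_integrable f ->
  circle_mean (fun z => c * f z) = c * circle_mean f.
Proof.
move=> [f1 f2]; have mD := @measurable_D R.
have Z r (u : R -> R) : mu.-integrable D (EFin \o u) ->
    mu.-integrable D (EFin \o (fun t => r * u t)) by exact: integrableZl.
apply: complex_eqP.
- rewrite ReM !Re_circle_mean ![complex.Re c * _]mulrCA ![complex.Im c * _]mulrCA.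
  rewrite -mulrBr -(RintegralZl _ mD f1) -(RintegralZl _ mD f2).
  rewrite -(RintegralB mD (Z _ _ f1) (Z _ _ f2)).
  by congr (_ * _); apply: eq_Rintegral => t _; rewrite ReM.
- rewrite ImM !Im_circle_mean Re_circle_mean.
  rewrite ![complex.Re c * _]mulrCA ![complex.Im c * _]mulrCA.
  rewrite -mulrDr -(RintegralZl _ mD f1) -(RintegralZl _ mD f2).
  rewrite -(RintegralD mD (Z _ _ f2) (Z _ _ f1)).
  by congr (_ * _); apply: eq_Rintegral => t _; rewrite ImM.
Qed.

Lemma circle_meanB f g : circle_integrable f -> circle_integrable g ->
  circle_mean (fun z => f z - g z) = circle_mean f - circle_mean g.
Proof.
move=> fi gi; rewrite -mulN1r -circle_meanZ // -circle_meanD //.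
  by apply: eq_circle_mean => t; rewrite mulN1r.
exact: circle_integrableZ.
Qed.

Lemma circle_mean_conj f : circle_integrable f ->
  circle_mean (fun z => (f z)^*) = (circle_mean f)^*.
Proof.
move=> [f1 f2]; have mD := @measurable_D R; rewrite conjCE.
apply: complex_eqP => /=.
- by congr (_ * _); apply: eq_Rintegral => t _; rewrite conjCE.
- rewrite -mulrN -mulN1r -(RintegralZl (-1) mD f2).
  by congr (_ * _); apply: eq_Rintegral => t _; rewrite conjCE /= mulN1r.
Qed.

Lemma circle_mean_cst c : circle_mean (fun=> c) = c.
Proof.
have mD := @measurable_D R.
have hD : fine (mu D) = 2 * pi.
  rewrite lebesgue_measure_itv /= lte_fin.
  by rewrite mulr_gt0 ?pi_gt0 //= subr0.
have pi2 : 2 * pi != 0 :> R by rewrite mulf_neq0 // gt_eqF // pi_gt0.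
by apply: complex_eqP; rewrite ?Re_circle_mean ?Im_circle_mean Rintegral_cst // hD mulrC mulfK.
Qed.

Lemma circle_mean_sum (I : eqType) (r : seq I) (P : pred I) (F : I -> C -> C) :
  (forall i, i \in r -> P i -> circle_integrable (F i)) ->
  circle_integrable (fun z => \sum_(i <- r | P i) F i z) /\
  circle_mean (fun z => \sum_(i <- r | P i) F i z) =
    \sum_(i <- r | P i) circle_mean (F i).
Proof.
elim: r => [_|i r IH iF].
  split; first by apply: eq_circle_integrable (circle_integrable_cst 0) => t; rewrite big_nil.
  rewrite big_nil -[RHS]circle_mean_cst.
  by apply: eq_circle_mean => t; rewrite big_nil.
have [|i1 i2] := IH; first by move=> j jr; apply: iF; rewrite in_cons jr orbT.
have [Pi|nPi] := boolP (P i).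
  have Fi : circle_integrable (F i) by apply: iF => //; rewrite mem_head.
  split.
    apply: eq_circle_integrable (circle_integrableD Fi i1) => t.
    by rewrite big_cons Pi.
  rewrite big_cons Pi -i2 -circle_meanD //.
  by apply: eq_circle_mean => t; rewrite big_cons Pi.
split; first by apply: eq_circle_integrable i1 => t; rewrite big_cons (negPf nPi).
rewrite big_cons (negPf nPi) -i2.
by apply: eq_circle_mean => t; rewrite big_cons (negPf nPi).
Qed.

Lemma circle_mean_ge0 f : (forall t, 0 <= f (circle_pt t)) ->
  0 <= circle_mean f.
Proof.
move=> f0; rewrite complex_leE; apply/andP; split.
  apply/eqP; rewrite Im_circle_mean.
  under eq_Rintegral => t _.
    have := f0 t; rewrite complex_leE => /andP[/eqP -> _].
    over.
  by rewrite Rintegral_cst ?mul0r ?mulr0 //; exact: measurable_D.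
rewrite Re_circle_mean mulr_ge0 ?invr_ge0 ?mulr_ge0 ?pi_ge0 //.
by apply: Rintegral_ge0 => t _; have := f0 t; rewrite complex_leE => /andP[].
Qed.

Lemma le_circle_mean f g : circle_integrable f -> circle_integrable g ->
  (forall t, f (circle_pt t) <= g (circle_pt t)) ->
  circle_mean f <= circle_mean g.
Proof.
move=> fi gi fg; rewrite -subr_ge0 -circle_meanB //.
by apply: circle_mean_ge0 => t; rewrite subr_ge0.
Qed.

(* Rotating [f] so that its mean is nonnegative reduces the bound to the
   monotonicity of the mean on real functions. *)
Lemma norm_circle_mean_le f h : circle_integrable f -> circle_integrable h ->
  (forall t, `|f (circle_pt t)| <= h (circle_pt t)) ->
  `|circle_mean f| <= circle_mean h.
Proof.
move=> fi hi fh; pose w := circle_mean f.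
have [w0|w0] := eqVneq w 0.
  rewrite -/w w0 normr0; apply: circle_mean_ge0 => t.
  exact: le_trans (normr_ge0 _) (fh t).
pose c := `|w| / w.
have c1 : `|c| = 1 by rewrite normrM normr_id normfV mulfV // normr_eq0.
have cw : c * w = `|w| by rewrite divfK.
have cfi := circle_integrableZ c fi.
have cfi' := circle_integrable_conj cfi.
rewrite -(@ler_pM2l _ 2) // !mulr_natl !mulr2n.
have -> : `|circle_mean f| + `|circle_mean f| =
    circle_mean (fun z => c * f z + (c * f z)^*).
  rewrite circle_meanD // circle_mean_conj // circle_meanZ // -/w cw.
  by rewrite geC0_conj.
rewrite -circle_meanD //; apply: le_circle_mean; [exact: circle_integrableD..|].
move=> t; set x := c * f _.
have xh : `|x| <= h (circle_pt t) by rewrite normrM c1 mul1r.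
apply: (@le_trans _ _ (`|x| + `|x|)); last exact: lerD.
have := Re_le_norm x; rewrite -Re_norm; move: (complex.Re `|x|) => r xr.
rewrite conjCE complex_leE !ReD !ImD /= subrr addr0 eqxx /=.
by rewrite lerD // (le_trans (ler_norm _)).
Qed.

End CircleMean.

(** * The inner product on square-integrable functions, and almost everywhere equality *)

Section SquareIntegrable.
Context {R : realType}.
Local Notation C := R[i].
Local Notation mu := (@lebesgue_measure R).
Local Notation D := (`[0, 2 * pi]%classic : set R).
Implicit Types (f g h : C -> C) (c : C).

(** The product of f with its conjugate is the integrand of [inner f f]: its real part is |f|^2 and
    its imaginary part is 0. In this form square integrability fits the closure lemmas for
    [circle_integrable]. *)
Lemma L2P f : L2 f <->
  circle_measurable f /\ circle_integrable (fun z => f z * (f z)^*).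
Proof.
have E t : complex.Re (f (circle_pt t) * (f (circle_pt t))^*) =
    complex.Re `|f (circle_pt t)| ^+ 2.
  by rewrite -normCK -Re_norm -rmorphXn.
have I0 t : complex.Im (f (circle_pt t) * (f (circle_pt t))^*) = 0.
  by rewrite -normCK -Re_norm -rmorphXn.
split => [[f1 f2 f3]|[[f1 f2] [/integrableP[g1 g2] _]]].
- have mf : circle_measurable f by [].
  split => //; have [m1 m2] := circle_measurableM mf (circle_measurable_conj mf).
  split; apply/integrableP; split; try exact/measurable_EFinP.
    under eq_integral => t _ do rewrite /= E ger0_norm ?sqr_ge0 //.
    exact: f3.
  under eq_integral => t _ do rewrite /= I0 normr0.
  by rewrite integral0 ltry.
- split => //; move: g2; under eq_integral => t _ do rewrite /= E ger0_norm ?sqr_ge0 //.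
  exact.
Qed.

Lemma L2_measurable f : L2 f -> circle_measurable f.
Proof. by case/L2P. Qed.
Hint Resolve L2_measurable : core.

(** Domination by |f|^2 + |g|^2, since x^2 + y^2 - x y = (x - y)^2 + x y for x, y >= 0. *)
Lemma inner_integrable f g : L2 f -> L2 g ->
  circle_integrable (fun z => f z * (g z)^*).
Proof.
move=> Lf Lg; have [[mf fi] [mg gi]] := ((L2P f).1 Lf, (L2P g).1 Lg).
apply: le_circle_integrable (circle_integrableD fi gi) _.
  exact: circle_measurableM mf (circle_measurable_conj mg).
move=> t; rewrite normrM norm_conjC -!normCK.
set x := `|f _|; set y := `|g _|; have x0 : 0 <= x := normr_ge0 _.
have y0 : 0 <= y := normr_ge0 _.
rewrite -subr_ge0; have -> : x ^+ 2 + y ^+ 2 - x * y =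
   (x - y) ^+ 2 + x * y by ring.
apply: addr_ge0; last exact: mulr_ge0.
by rewrite real_exprn_even_ge0 // rpredB // ger0_real.
Qed.

Lemma L2D f g : L2 f -> L2 g -> L2 (fun z => f z + g z).
Proof.
move=> Lf Lg; apply/L2P; split; first by apply: circle_measurableD; exact: L2_measurable.
apply: (@eq_circle_integrable _ (fun z => f z * (f z)^* + f z * (g z)^* +
    (g z * (f z)^* + g z * (g z)^*))).
  by move=> t; rewrite rmorphD /=; ring.
by do 2 apply: circle_integrableD; exact: inner_integrable.
Qed.

Lemma L2_bounded f (M : C) : circle_measurable f ->
  (forall t, `|f (circle_pt t)| <= M) -> L2 f.
Proof.
move=> mf fM; apply/L2P; split => //.
apply: (@circle_integrable_bounded _ _ (M ^+ 2)).
  exact: circle_measurableM mf (circle_measurable_conj mf).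
by move=> t; rewrite -normCK ger0_norm ?exprn_ge0 // lerXn2r ?nnegrE // (le_trans _ (fM t)).
Qed.

Lemma L2_boundedM h f (M : C) : circle_measurable h ->
  (forall t, `|h (circle_pt t)| <= M) -> L2 f -> L2 (fun z => h z * f z).
Proof.
move=> mh hM Lf; have mf := L2_measurable Lf; apply/L2P; split.
  exact: circle_measurableM.
have /(circle_integrableZ (M ^+ 2)) H := inner_integrable Lf Lf.
apply: (le_circle_integrable _ H).
  by apply: circle_measurableM; [|apply: circle_measurable_conj]; exact: circle_measurableM.
move=> t; rewrite -!normCK ger0_norm ?exprn_ge0 // normrM exprMn ler_wpM2r ?exprn_ge0 //.
by rewrite lerXn2r ?nnegrE // (le_trans _ (hM t)).
Qed.

Lemma L2Z c f : L2 f -> L2 (fun z => c * f z).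
Proof. exact: L2_boundedM (circle_measurable_cst c) (fun=> lexx _). Qed.

Lemma eq_L2 f g : (forall t, f (circle_pt t) = g (circle_pt t)) -> L2 f -> L2 g.
Proof.
move=> fg /L2P[mf fi]; apply/L2P; split; first exact: eq_circle_measurable mf.
by apply: eq_circle_integrable fi => t; rewrite fg.
Qed.

Lemma L2B f g : L2 f -> L2 g -> L2 (fun z => f z - g z).
Proof.
move=> Lf Lg; apply: eq_L2 (L2D Lf (L2Z (-1) Lg)) => t.
by rewrite mulN1r.
Qed.

Lemma L2_sum (I : Type) (r : seq I) (P : pred I) (F : I -> C -> C) :
  (forall i, L2 (F i)) -> L2 (fun z => \sum_(i <- r | P i) F i z).
Proof.
move=> LF; elim: r => [|i r IH].
  apply: (@eq_L2 (fun=> 0)); first by move=> t; rewrite big_nil.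
  by apply: (@L2_bounded _ 0) => [|t]; [exact: circle_measurable_cst|rewrite normr0].
have [Pi|nPi] := boolP (P i).
  by apply: eq_L2 (L2D (LF i) IH) => t; rewrite big_cons Pi.
by apply: eq_L2 IH => t; rewrite big_cons (negPf nPi).
Qed.

Lemma eq_inner f f' g g' :
  (forall t, f (circle_pt t) = f' (circle_pt t)) ->
  (forall t, g (circle_pt t) = g' (circle_pt t)) -> inner f g = inner f' g'.
Proof. by move=> ff' gg'; apply: eq_circle_mean => t; rewrite ff' gg'. Qed.

Lemma innerC f g : L2 f -> L2 g -> inner g f = (inner f g)^*.
Proof.
move=> Lf Lg; rewrite -circle_mean_conj; last exact: inner_integrable.
by apply: eq_circle_mean => t; rewrite rmorphM /= conjCK mulrC.
Qed.

Lemma innerDl f g h : L2 f -> L2 g -> L2 h ->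
  inner (fun z => f z + g z) h = inner f h + inner g h.
Proof.
move=> Lf Lg Lh; rewrite -circle_meanD; [|exact: inner_integrable..].
by apply: eq_circle_mean => t; rewrite mulrDl.
Qed.

Lemma innerZl c f h : L2 f -> L2 h -> inner (fun z => c * f z) h = c * inner f h.
Proof.
move=> Lf Lh; rewrite -circle_meanZ; last exact: inner_integrable.
by apply: eq_circle_mean => t; rewrite mulrA.
Qed.

Lemma innerBl f g h : L2 f -> L2 g -> L2 h ->
  inner (fun z => f z - g z) h = inner f h - inner g h.
Proof.
move=> Lf Lg Lh; rewrite -mulN1r -innerZl // -innerDl //; last exact: L2Z.
by apply: eq_inner => // t; rewrite mulN1r.
Qed.

Lemma innerZr c f h : L2 f -> L2 h -> inner h (fun z => c * f z) = c^* * inner h f.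
Proof.
by move=> Lf Lh; rewrite innerC // ?innerZl // ?rmorphM /= -?innerC //; exact: L2Z.
Qed.

Lemma innerBr f g h : L2 f -> L2 g -> L2 h ->
  inner h (fun z => f z - g z) = inner h f - inner h g.
Proof.
by move=> Lf Lg Lh; rewrite innerC // ?innerBl // ?rmorphB /= -?innerC //; exact: L2B.
Qed.

Lemma inner_suml (I : Type) (r : seq I) (P : pred I) (F : I -> C -> C) h :
  (forall i, L2 (F i)) -> L2 h ->
  inner (fun z => \sum_(i <- r | P i) F i z) h = \sum_(i <- r | P i) inner (F i) h.
Proof.
move=> LF Lh; elim: r => [|i r IH].
  rewrite big_nil -[RHS](@circle_mean_cst R).
  by apply: eq_circle_mean => t; rewrite big_nil mul0r.
rewrite big_cons; have [Pi|nPi] := boolP (P i).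
  rewrite -IH -innerDl //; last exact: L2_sum.
  by apply: eq_inner => // t; rewrite big_cons Pi.
by rewrite -IH; apply: eq_inner => // t; rewrite big_cons (negPf nPi).
Qed.

Lemma inner_sumr (I : Type) (r : seq I) (P : pred I) (F : I -> C -> C) h :
  (forall i, L2 (F i)) -> L2 h ->
  inner h (fun z => \sum_(i <- r | P i) F i z) = \sum_(i <- r | P i) inner h (F i).
Proof.
move=> LF Lh; rewrite innerC //; last exact: L2_sum.
by rewrite inner_suml // rmorph_sum /=; apply: eq_bigr => i _; rewrite -innerC.
Qed.

Lemma inner_ge0 f : 0 <= inner f f.
Proof. by apply: circle_mean_ge0 => t; exact: mul_conjC_ge0. Qed.

Lemma inner_CauchySchwarz f g : L2 f -> L2 g ->
  `|inner f g| ^+ 2 <= inner f f * inner g g.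
Proof.
move=> Lf Lg; set a := inner f f; set b := inner g g; set p := inner f g.
have a0 : 0 <= a := inner_ge0 f; have b0 : 0 <= b := inner_ge0 g.
have expand (x y : C) :
    0 <= x * x^* * a - x * y^* * p - y * x^* * p^* + y * y^* * b.
  have := inner_ge0 (fun z => x * f z - y * g z).
  have Lx := L2Z x Lf; have Ly := L2Z y Lg.
  rewrite innerBl //; [|exact: L2B].
  rewrite !innerBr // !innerZl // !innerZr // (innerC Lf Lg).
  by congr (0 <= _); rewrite -/a -/b -/p; ring.
have [b_eq0|bn0] := eqVneq b 0.
  rewrite b_eq0 mulr0 normCK.
  have [->//|pp] := eqVneq (p * p^*) 0.
  (* The norm of g may vanish without g being 0 as a function, so this case needs its own argument.
     If p were nonzero, x = 1 and y = s p would turn the form into a - 2 (a + 1), which is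
     negative. *)
  pose s := (a + 1) / (p * p^*).
  have s0 : 0 <= s by rewrite divr_ge0 ?addr_ge0 // mul_conjC_ge0.
  have := expand 1 (s * p); rewrite b_eq0 mulr0 addr0 rmorphM /= rmorph1.
  rewrite (geC0_conj s0); have -> : 1 * 1 * a - 1 * (s * p^*) * p - s * p * 1 * p^* =
    a - 2 * (s * (p * p^*)) by ring.
  rewrite /s divfK // subr_ge0 => H; exfalso.
  have : a + 1 + 1 <= 0.
    by rewrite -(lerD2r a) add0r (le_trans _ H) // le_eqVlt; apply/orP; left; apply/eqP; ring.
  have H1 : 0 < a + 1 + 1 by rewrite addr_gt0 // ltr_wpDl.
  by move=> /(lt_le_trans H1); rewrite ltxx.
(* With x = b and y = p the form factors as b (a b - |p|^2). *)
have := expand b p; rewrite (geC0_conj b0).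
have -> : b * b * a - b * p^* * p - p * b * p^* + p * p^* * b =
  b * (a * b - p * p^*) by ring.
by rewrite pmulr_rge0 ?lt_def ?bn0 // subr_ge0 normCK.
Qed.

Let aeF := ae_filter_ringOfSetsType mu.

Lemma inner_eq0 f : L2 f -> inner f f = 0 -> ae_circle (fun z => f z = 0).
Proof.
move=> Lf ff0; have [/integrableP[g1 g2] _] := inner_integrable Lf Lf.
have E t : complex.Re (f (circle_pt t) * (f (circle_pt t))^*) =
    complex.Re `|f (circle_pt t)| ^+ 2.
  by rewrite -normCK -Re_norm -rmorphXn.
have J : (\int[mu]_(x in D)
    `|(EFin \o (fun t : R => complex.Re (f (circle_pt t) * (f (circle_pt t))^*)%R)) x|)%E
    = (\int[mu]_(x in D) (complex.Re (f (circle_pt x) * (f (circle_pt x))^*)%R)%:E)%E.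
  by apply: eq_integral => t _; rewrite /= E ger0_norm // sqr_ge0.
have fin : (\int[mu]_(x in D) (complex.Re (f (circle_pt x) * (f (circle_pt x))^*)%R)%:E)%E
    \is a fin_num.
  rewrite ge0_fin_numE; first by rewrite -J.
  by apply: integral_ge0 => t _; rewrite lee_fin E sqr_ge0.
have int0 : (\int[mu]_(x in D)
    `|(EFin \o (fun t : R => complex.Re (f (circle_pt t) * (f (circle_pt t))^*)%R)) x|)%E = 0%E.
  have := congr1 (@complex.Re R) ff0; rewrite Re_circle_mean /= => /eqP.
  rewrite mulf_eq0 invr_eq0 mulf_eq0 pnatr_eq0 (gt_eqF (pi_gt0 R)) !orbF /=.
  by rewrite /Rintegral => /eqP H; rewrite J -(fineK fin) H.
have := (ae_eq_integral_abs mu measurable_D g1).1 int0.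
apply: (@filterS _ _ aeF) => t H Dt.
have {H} /eqP := H Dt; rewrite /= E eqe expf_eq0 /= => /eqP N0.
exact: Normc.eq0_normc N0.
Qed.

Lemma ae_circleW (P : C -> Prop) : (forall t, P (circle_pt t)) -> ae_circle P.
Proof. by move=> HP; apply: aeW => t _. Qed.

Lemma ae_circleI (P Q : C -> Prop) : ae_circle P -> ae_circle Q ->
  ae_circle (fun z => P z /\ Q z).
Proof.
move=> HP HQ; apply: (@filterS _ _ aeF _ _ _ (@filterI _ _ aeF _ _ HP HQ)).
by move=> t [h1 h2] Dt; split; [exact: h1|exact: h2].
Qed.

Lemma ae_circleS (P Q : C -> Prop) : (forall t, P (circle_pt t) -> Q (circle_pt t)) ->
  ae_circle P -> ae_circle Q.
Proof.
by move=> PQ; apply: (@filterS _ _ aeF) => t h Dt; exact/PQ/h.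
Qed.

(** Merges finitely many null sets, so that the expansions of all vectors of a basis can be
    substituted at the same point. *)
Lemma ae_circle_forall (I : eqType) (r : seq I) (P : I -> C -> Prop) :
  (forall i, ae_circle (P i)) -> ae_circle (fun z => forall i, i \in r -> P i z).
Proof.
move=> HP; elim: r => [|i r IH]; first exact: ae_circleW.
apply: ae_circleS (ae_circleI (HP i) IH) => t [h1 h2] j.
by rewrite in_cons => /orP[/eqP->|/h2].
Qed.

Lemma ae_circle_mean f g : circle_measurable f -> circle_integrable g ->
  ae_circle (fun z => f z = g z) ->
  circle_integrable f /\ circle_mean f = circle_mean g.
Proof.
move=> [f1 f2] [g1 g2] fg.
have H (u v : R -> R) : measurable_fun D u -> mu.-integrable D (EFin \o v) ->
    ae_eq mu D (EFin \o u) (EFin \o v) ->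
    mu.-integrable D (EFin \o u) /\
    \int[mu]_(t in D) u t = \int[mu]_(t in D) v t.
  move=> mu_ iv uv; have mu' : measurable_fun D (EFin \o u) by exact/measurable_EFinP.
  have /integrableP[mv vi] := iv; split.
    apply/integrableP; split => //.
    apply: (le_lt_trans _ vi); rewrite le_eqVlt; apply/orP; left; apply/eqP.
    apply: (@ae_eq_integral _ _ R mu D (abse \o (EFin \o v)) (abse \o (EFin \o u)) measurable_D).
    - exact: measurableT_comp mu'.
    - exact: measurableT_comp mv.
    - exact: ae_eq_comp.
  congr fine.
  exact: (@ae_eq_integral _ _ R mu D (EFin \o v) (EFin \o u) measurable_D mu' mv uv).
have [|i1 e1] := H _ _ f1 g1.
  by apply: (@filterS _ _ aeF) fg => t h Dt /=; rewrite h.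
have [|i2 e2] := H _ _ f2 g2.
  by apply: (@filterS _ _ aeF) fg => t h Dt /=; rewrite h.
by split => //; rewrite /circle_mean e1 e2.
Qed.

Lemma ae_L2 f g : circle_measurable f -> L2 g -> ae_circle (fun z => f z = g z) -> L2 f.
Proof.
move=> mf Lg fg; apply/L2P; split=> //.
have [] // := @ae_circle_mean (fun z => f z * (f z)^*) _ _ (inner_integrable Lg Lg) _.
  exact: circle_measurableM mf (circle_measurable_conj mf).
by apply: ae_circleS fg => t ->.
Qed.

Lemma ae_inner f f' g g' : L2 f -> L2 f' -> L2 g -> L2 g' ->
  ae_circle (fun z => f z = f' z) -> ae_circle (fun z => g z = g' z) ->
  inner f g = inner f' g'.
Proof.
move=> Lf Lf' Lg Lg' ff' gg'.
have [] // := @ae_circle_mean (fun z => f z * (g z)^*) _ _ (inner_integrable Lf' Lg') _.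
  by apply: circle_measurableM; [|apply: circle_measurable_conj]; exact: L2_measurable.
by apply: ae_circleS (ae_circleI ff' gg') => t [-> ->].
Qed.

End SquareIntegrable.

(** * Bounded multipliers and the orthogonality of the monomials *)

Section CircleMonomials.
Context {R : realType}.
Local Notation C := R[i].
Local Notation mu := (@lebesgue_measure R).
Local Notation D := (`[0, 2 * pi]%classic : set R).
Implicit Types (f g h : C -> C) (c : C) (t : R).

Lemma norm_circle_pt t : `|circle_pt t| = 1.
Proof. by rewrite normCE /= cos2Dsin2 sqrtr1. Qed.

Lemma circle_pt_neq0 t : circle_pt t != 0.
Proof. by rewrite -normr_eq0 norm_circle_pt oner_eq0. Qed.

Lemma norm_circle_ptz t (n : int) : `|circle_pt t ^ n| = 1.
Proof. by case: n => n; rewrite ?normfV normrX norm_circle_pt expr1n ?invr1. Qed.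

Lemma unimodular_conj (z : C) : `|z| = 1 -> z^* = z^-1.
Proof. by move=> z1; rewrite [RHS]invC_norm z1 expr1n invr1 mul1r. Qed.

Lemma conj_circle_pt t : (circle_pt t)^* = (circle_pt t)^-1.
Proof. exact/unimodular_conj/norm_circle_pt. Qed.

(** The algebra of multipliers of [L2] used below: the symbol may be unbounded, so its products stay
    in [L2] because the other factor belongs to this class. *)
Definition circle_bounded f :=
  circle_measurable f /\ exists M : C, forall t, `|f (circle_pt t)| <= M.

Lemma circle_bounded_cst c : circle_bounded (fun=> c).
Proof. by split; [exact: circle_measurable_cst|exists `|c|]. Qed.

Lemma circle_bounded_id : circle_bounded id.
Proof.
by split; [exact: circle_measurable_id|exists 1 => t; rewrite norm_circle_pt].
Qed.

Lemma circle_boundedD f g : circle_bounded f -> circle_bounded g ->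
  circle_bounded (fun z => f z + g z).
Proof.
move=> [mf [M fM]] [mg [N gN]]; split; first exact: circle_measurableD.
by exists (M + N) => t; rewrite (le_trans (ler_normD _ _)) // lerD.
Qed.

Lemma circle_boundedM f g : circle_bounded f -> circle_bounded g ->
  circle_bounded (fun z => f z * g z).
Proof.
move=> [mf [M fM]] [mg [N gN]]; split; first exact: circle_measurableM.
by exists (M * N) => t; rewrite normrM ler_pM.
Qed.

Lemma circle_bounded_conj f : circle_bounded f -> circle_bounded (fun z => (f z)^*).
Proof.
move=> [mf [M fM]]; split; first exact: circle_measurable_conj.
by exists M => t; rewrite norm_conjC.
Qed.

Lemma eq_circle_bounded f g : (forall t, f (circle_pt t) = g (circle_pt t)) ->
  circle_bounded f -> circle_bounded g.
Proof.
move=> fg [mf [M fM]]; split; first exact: eq_circle_measurable mf.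
by exists M => t; rewrite -fg.
Qed.

Lemma circle_boundedB f g : circle_bounded f -> circle_bounded g ->
  circle_bounded (fun z => f z - g z).
Proof.
move=> bf bg; apply: eq_circle_bounded
  (circle_boundedD bf (circle_boundedM (circle_bounded_cst (-1)) bg)) => t.
by rewrite mulN1r.
Qed.

Lemma circle_boundedX f n : circle_bounded f -> circle_bounded (fun z => f z ^+ n).
Proof.
move=> bf; elim: n => [|n IH]; first exact: circle_bounded_cst.
by apply: eq_circle_bounded (circle_boundedM bf IH) => t; rewrite exprS.
Qed.

Lemma circle_bounded_prod (I : Type) (r : seq I) (F : I -> C -> C) :
  (forall i, circle_bounded (F i)) -> circle_bounded (fun z => \prod_(i <- r) F i z).
Proof.
move=> bF; elim: r => [|i r IH].
  by apply: eq_circle_bounded (circle_bounded_cst 1) => t; rewrite big_nil.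
by apply: eq_circle_bounded (circle_boundedM (bF i) IH) => t; rewrite big_cons.
Qed.

Lemma circle_boundedV f (e : C) : 0 < e -> (forall t, e <= `|f (circle_pt t)|) ->
  circle_bounded f -> circle_bounded (fun z => (f z)^-1).
Proof.
move=> e0 ef [mf _]; split; first exact: circle_measurableV.
exists e^-1 => t; rewrite normfV lef_pV2 ?posrE //.
exact: lt_le_trans e0 (ef t).
Qed.

Lemma circle_bounded_exprz f (n : int) : circle_bounded f ->
  (forall t, `|f (circle_pt t)| = 1) -> circle_bounded (fun z => f z ^ n).
Proof.
move=> bf f1; case: n => n; first exact: circle_boundedX.
apply: (@circle_boundedV _ 1) => // [t|]; last exact: circle_boundedX.
by rewrite normrX f1 expr1n.
Qed.

Lemma circle_bounded_L2 f : circle_bounded f -> L2 f.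
Proof. by move=> [mf [M fM]]; exact: L2_bounded fM. Qed.

Lemma circle_bounded_integrable f : circle_bounded f -> circle_integrable f.
Proof. by move=> [mf [M fM]]; exact: circle_integrable_bounded fM. Qed.

Lemma circle_boundedM_L2 h f : circle_bounded h -> L2 f -> L2 (fun z => h z * f z).
Proof. by move=> [mh [M hM]]; exact: L2_boundedM hM. Qed.

Lemma circle_bounded_exprz_id n : circle_bounded (fun z : C => z ^ n).
Proof. by apply: circle_bounded_exprz; [exact: circle_bounded_id|exact: norm_circle_pt]. Qed.

Lemma Rintegral_periodic (F f : R -> R) : (forall x : R, is_derive x 1 F (f x)) ->
  continuous f -> F 0 = F (2 * pi) -> \int[mu]_(x in D) f x = 0.
Proof.
move=> dF cf F0; rewrite /Rintegral.
have dF' x : derivable F x 1 by apply: ex_derive.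
have cF x : {for x, continuous F}.
  by apply: differentiable_continuous; apply/derivable1_diffP.
rewrite (@continuous_FTC2 _ f F) //.
- by rewrite F0 subee.
- by rewrite mulr_gt0 // pi_gt0.
- exact: continuous_subspaceT.
- split => //.
  + by apply: cvg_at_right_filter; exact: cF.
  + by apply: cvg_at_left_filter; exact: cF.
- by move=> x _; rewrite derive1E; apply: derive_val.
Qed.

Lemma circle_ptX t n : circle_pt t ^+ n = circle_pt (n%:R * t).
Proof.
elim: n => [|n IH]; first by rewrite mul0r /circle_pt cos0 sin0.
rewrite exprS IH -natr1 mulrDl mul1r addrC /circle_pt.
by apply: complex_eqP; rewrite ?ReM ?ImM /= ?cosD ?sinD // addrC.
Qed.

Lemma circle_mean_expr n : (0 < n)%N -> circle_mean (fun z : C => z ^+ n) = 0.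
Proof.
move=> n0; have nn0 : n%:R != 0 :> R by rewrite pnatr_eq0 -lt0n.
have per (k : nat) : k%:R * (2 * pi) = (pi *+ 2) *+ k :> R.
  by rewrite !mulr_natl.
have dl (x : R) : is_derive x 1 (n%:R *: id : R -> R) (n%:R : R).
  by apply: trigger_derive; rewrite /GRing.scale /= mulr1.
have cl : continuous (fun x : R => n%:R * x : R).
  exact: mulrl_continuous.
apply: complex_eqP; rewrite ?Re_circle_mean ?Im_circle_mean.
- under eq_Rintegral => t _ do rewrite circle_ptX /=.
  rewrite [X in _ * X = _](_ : _ = 0) ?mulr0 //.
  apply: (@Rintegral_periodic (n%:R^-1 \*: (sin \o (n%:R *: id : R -> R)))).
  + move=> x.
    have h : is_derive x 1 (sin \o (n%:R *: id : R -> R)) (cos (n%:R * x) * n%:R).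
      exact: is_derive1_comp.
    have := @is_deriveZ R R R _ (n%:R^-1) _ _ _ h; congr (is_derive _ _ _ _).
    by rewrite /GRing.scale /= mulrCA mulVf // mulr1.
  + by move=> x; apply: continuous_comp; [exact: cl|exact: continuous_cos].
  + rewrite /GRing.scale /= /GRing.scale /= mulr0 sin0 per.
    by rewrite -[pi *+ 2 *+ n]add0r (periodicn (@sinD2pi R)) sin0.
- under eq_Rintegral => t _ do rewrite circle_ptX /=.
  rewrite [X in _ * X = _](_ : _ = 0) ?mulr0 //.
  apply: (@Rintegral_periodic (- n%:R^-1 \*: (cos \o (n%:R *: id : R -> R)))).
  + move=> x.
    have h : is_derive x 1 (cos \o (n%:R *: id : R -> R)) (- sin (n%:R * x) * n%:R).
      exact: is_derive1_comp.
    have := @is_deriveZ R R R _ (- n%:R^-1) _ _ _ h; congr (is_derive _ _ _ _).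
    by rewrite /GRing.scale /= !mulNr mulrN opprK mulrCA mulVf // mulr1.
  + by move=> x; apply: continuous_comp; [exact: cl|exact: continuous_sin].
  + rewrite /GRing.scale /= /GRing.scale /= mulr0 cos0 per.
    by rewrite -[pi *+ 2 *+ n]add0r (periodicn (@cosD2pi R)) cos0.
Qed.

Lemma circle_mean_exprz (n : int) : circle_mean (fun z : C => z ^ n) = (n == 0)%:R.
Proof.
case: n => [[|n]|n].
- by rewrite -[RHS](@circle_mean_cst R).
- by rewrite -[RHS](@circle_mean_expr n.+1).
- have bn : circle_bounded (fun z : C => z ^+ n.+1).
    exact/circle_boundedX/circle_bounded_id.
  transitivity (circle_mean (fun z : C => (z ^+ n.+1)^*)).
    by apply: eq_circle_mean => t; rewrite rmorphXn /= conj_circle_pt exprVn.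
  rewrite circle_mean_conj ?circle_mean_expr ?rmorph0 //.
  exact: circle_bounded_integrable.
Qed.

Lemma inner_exprz (n k : int) :
  inner (fun z : C => z ^ n) (fun z => z ^ k) = (n == k)%:R.
Proof.
rewrite -subr_eq0 -circle_mean_exprz; apply: eq_circle_mean => t.
have z0 := circle_pt_neq0 t; rewrite expfzDr // -exprz_inv; congr (_ * _).
rewrite -conj_circle_pt; case: k => k; first by rewrite rmorphXn.
by rewrite fmorphV rmorphXn.
Qed.

End CircleMonomials.

(** * The Hardy space, the Szego kernel and Blaschke factors *)

Section HardySpace.
Context {R : realType}.
Local Notation C := R[i].
Implicit Types (f g h : C -> C) (c l : C) (t : R).

Lemma Hardy2_L2 f : Hardy2 f -> L2 f.
Proof. by case. Qed.

Lemma L2_exprz (n : int) : L2 (fun z : C => z ^ n).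
Proof. exact/circle_bounded_L2/circle_bounded_exprz_id. Qed.

Lemma eq_Hardy2 f g : (forall t, f (circle_pt t) = g (circle_pt t)) ->
  Hardy2 f -> Hardy2 g.
Proof.
move=> fg [Lf Hf]; split; first exact: eq_L2 Lf.
by move=> n n0; rewrite -(Hf n n0); apply: eq_inner.
Qed.

Lemma Hardy2D f g : Hardy2 f -> Hardy2 g -> Hardy2 (fun z => f z + g z).
Proof.
move=> [Lf Hf] [Lg Hg]; split; first exact: L2D.
move=> n n0; rewrite /fourier innerDl //; last exact: L2_exprz.
by rewrite -!/(fourier _ n) Hf // Hg // addr0.
Qed.

Lemma Hardy2Z c f : Hardy2 f -> Hardy2 (fun z => c * f z).
Proof.
move=> [Lf Hf]; split; first exact: L2Z.
move=> n n0; rewrite /fourier innerZl //; last exact: L2_exprz.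
by rewrite -/(fourier _ n) Hf // mulr0.
Qed.

Lemma Hardy2B f g : Hardy2 f -> Hardy2 g -> Hardy2 (fun z => f z - g z).
Proof.
move=> Hf Hg; apply: eq_Hardy2 (Hardy2D Hf (Hardy2Z (-1) Hg)) => t.
by rewrite mulN1r.
Qed.

Lemma Hardy2_cst c : Hardy2 (fun=> c).
Proof.
apply: (@eq_Hardy2 (fun z => c * z ^ 0)); first by move=> t; rewrite mulr1.
apply: Hardy2Z; split; first exact: L2_exprz.
by move=> n n0; rewrite /fourier inner_exprz gt_eqF.
Qed.

Lemma Hardy2_sum (I : Type) (r : seq I) (F : I -> C -> C) :
  (forall i, Hardy2 (F i)) -> Hardy2 (fun z => \sum_(i <- r) F i z).
Proof.
move=> HF; elim: r => [|i r IH].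
  by apply: eq_Hardy2 (Hardy2_cst 0) => t; rewrite big_nil.
by apply: eq_Hardy2 (Hardy2D (HF i) IH) => t; rewrite big_cons.
Qed.

Lemma conjV (x : C) : (x^-1)^* = (x^*)^-1.
Proof. exact: fmorphV. Qed.

Lemma conj_circle_ptz t (n : int) : (circle_pt t ^ n)^* = circle_pt t ^ (- n).
Proof.
rewrite -exprz_inv -conj_circle_pt; exact: fmorphXz.
Qed.

Lemma inner_mulz f (n : int) :
  inner (fun z => z * f z) (fun z => z ^ n) = inner f (fun z => z ^ (n - 1)).
Proof.
apply: eq_circle_mean => t; have z0 := circle_pt_neq0 t.
by rewrite !conj_circle_ptz opprB expfzDr // expr1z mulrCA mulrA.
Qed.

Lemma L2_mulz f : L2 f -> L2 (fun z => z * f z).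
Proof. exact/circle_boundedM_L2/circle_bounded_id. Qed.

Lemma Hardy2_mulz f : Hardy2 f -> Hardy2 (fun z => z * f z).
Proof.
move=> [Lf Hf]; split; first exact: L2_mulz.
by move=> n n0; rewrite /fourier inner_mulz -/(fourier _ (n - 1)) Hf //; lia.
Qed.

(** Iteration gives v k = c^n v (k + n), of modulus at most |c|^n M for every n. It serves to
    annihilate Fourier coefficients without expanding the kernel in a power series. *)
Lemma geometric_eq0 (v : nat -> C) c (M : C) : `|c| < 1 ->
  (forall k, `|v k| <= M) -> (forall k, v k = c * v k.+1) -> forall k, v k = 0.
Proof.
move=> c1 vM vS; pose r := complex.Re `|c|; pose B := complex.Re M.
have cr : `|c| = r%:C%C by rewrite Re_norm.
have r1 : `|r| < 1 by rewrite ger0_norm -?ltcR -?cr // -ler0c -cr.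
move=> k; apply/eqP; rewrite -normr_eq0 eq_le normr_ge0 andbT.
have vn n : complex.Re `|v k| <= B * r ^+ n.
  have : `|v k| <= `|c| ^+ n * M.
    elim: n k => [|n IH] k; first by rewrite mul1r.
    by rewrite vS normrM exprS -mulrA ler_wpM2l.
  rewrite cr -rmorphXn mulrC complex_leE ReM /= mulr0 subr0 => /andP[_ //].
rewrite -Re_norm -[0]/((0 : R)%:C%C) lecR.
have := @cvg_geometric R B r r1 => cv.
rewrite -(cvg_lim _ cv) //; apply: limr_ge; first by apply/cvg_ex; exists 0.
by apply: nearW => n; exact: vn.
Qed.

(** The reproducing kernel of the Hardy space: [inner f (szego l)] is the value at l of the
    holomorphic extension of f, and replaces that value throughout, because functions are only
    considered on the circle. *)
Definition szego l : C -> C := fun z => (1 - l^* * z)^-1.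

Definition blaschke_factor l : C -> C := fun z => (z - l) / (1 - l^* * z).

Lemma szego_denom_ge l t : `|l| < 1 -> 1 - `|l| <= `|1 - l^* * circle_pt t|.
Proof.
move=> l1; apply: le_trans (lerB_dist _ _).
by rewrite normr1 normrM norm_circle_pt mulr1 norm_conjC.
Qed.

Lemma szego_denom_neq0 l t : `|l| < 1 -> 1 - l^* * circle_pt t != 0.
Proof.
move=> l1; rewrite -normr_gt0 (lt_le_trans _ (szego_denom_ge t l1)) //.
by rewrite subr_gt0.
Qed.

Lemma circle_pt_subr_neq0 l t : `|l| < 1 -> circle_pt t - l != 0.
Proof.
move=> l1; rewrite subr_eq0; apply/eqP => E.
by move: l1; rewrite -E norm_circle_pt ltxx.
Qed.

Lemma conj_szego_denom l t :
  (1 - l^* * circle_pt t)^* = (circle_pt t - l) / circle_pt t.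
Proof.
rewrite rmorphB rmorph1 rmorphM /= conjCK conj_circle_pt mulrBl divff //.
exact: circle_pt_neq0.
Qed.

Lemma circle_bounded_szego l : `|l| < 1 -> circle_bounded (szego l).
Proof.
move=> l1; apply: (@circle_boundedV _ _ (1 - `|l|)); first by rewrite subr_gt0.
  by move=> t; exact: szego_denom_ge.
apply: circle_boundedB; first exact: circle_bounded_cst.
exact: circle_boundedM (circle_bounded_cst _) circle_bounded_id.
Qed.

Lemma circle_bounded_factor l : `|l| < 1 -> circle_bounded (blaschke_factor l).
Proof.
move=> l1; apply: circle_boundedM; last exact: circle_bounded_szego.
exact: circle_boundedB circle_bounded_id (circle_bounded_cst _).
Qed.

Lemma norm_blaschke_factor l t : `|l| < 1 -> `|blaschke_factor l (circle_pt t)| = 1.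
Proof.
move=> l1; have d0 := szego_denom_neq0 t l1.
rewrite normrM normfV -[`|1 - _|]norm_conjC conj_szego_denom normrM normfV.
by rewrite norm_circle_pt invr1 mulr1 divff // normr_eq0 circle_pt_subr_neq0.
Qed.

(** The product g satisfies g = f + l^* z g. As f has no negative coefficients, the coefficient v k
    of g at -(k+1) is l^* times v (k+1), and a bounded sequence with this property is 0. *)
Lemma Hardy2_szegoM l f : `|l| < 1 -> Hardy2 f -> Hardy2 (fun z => szego l z * f z).
Proof.
move=> l1 [Lf Hf]; set g := fun z => _.
have Lg : L2 g := circle_boundedM_L2 (circle_bounded_szego l1) Lf.
split => // n n0.
pose v (k : nat) : C := inner g (fun z => z ^ (- k.+1%:Z)).
suff v0 k : v k = 0.
  have -> : n = - (absz n).-1.+1%:Z by lia.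
  exact: v0.
(* The bound comes from |v k|^2 <= [inner g g] and x <= x^2 + 1, which avoids a square root. *)
apply: (@geometric_eq0 v l^* (inner g g + 1)); rewrite ?norm_conjC // => {}k.
- have := inner_CauchySchwarz Lg (L2_exprz (- k.+1%:Z)).
  rewrite inner_exprz eqxx mulr1 => H.
  have g0 := inner_ge0 g.
  apply: (@le_trans _ _ (`|v k| ^+ 2 + 1)); last by rewrite lerD2r.
  rewrite -subr_ge0; set x := `|v k|.
  have -> : x ^+ 2 + 1 - x = (x - 2^-1) ^+ 2 + (2^-1 + 2^-1 ^+ 2) by field.
  apply: addr_ge0; last by rewrite addr_ge0 ?exprn_ge0 ?invr_ge0.
  by rewrite real_exprn_even_ge0 // rpredB // ger0_real ?invr_ge0 // /x.
- transitivity (inner (fun z => f z + l^* * (z * g z)) (fun z : C => z ^ (- k.+1%:Z))).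
    apply: eq_inner => // t; rewrite /g /szego; have := szego_denom_neq0 t l1.
    by move=> d0; field.
  have LE := L2_exprz (- k.+1%:Z).
  rewrite innerDl ?innerZl //; [|exact: L2_mulz|exact/L2Z/L2_mulz].
  rewrite -[inner f _]/(fourier f _) Hf ?add0r; last by lia.
  congr (_ * _); rewrite inner_mulz; apply: eq_inner => // t; congr (_ ^ _); lia.
Qed.

Lemma Hardy2_factorM l f : `|l| < 1 -> Hardy2 f ->
  Hardy2 (fun z => blaschke_factor l z * f z).
Proof.
move=> l1 /(Hardy2_szegoM l1) H; apply: eq_Hardy2 (Hardy2B (Hardy2_mulz H) (Hardy2Z l H)) => t.
by rewrite /blaschke_factor /szego; ring.
Qed.

(** Vanishing at l. On the circle the factor times the conjugate of the kernel equals z times the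
    kernel, so the inner product is the mean of z times a Hardy function, that is, its Fourier
    coefficient at -1. *)
Lemma inner_factor_szego l f : `|l| < 1 -> Hardy2 f ->
  inner (fun z => blaschke_factor l z * f z) (szego l) = 0.
Proof.
move=> l1 /(Hardy2_szegoM l1)[_ H].
transitivity (inner (fun z => z * (szego l z * f z)) (fun z : C => z ^ 0)); last first.
  by rewrite inner_mulz sub0r -/(fourier _ (-1)) H.
apply: eq_circle_mean => t.
rewrite rmorph1 mulr1 /blaschke_factor /szego conjV conj_szego_denom.
have := circle_pt_subr_neq0 t l1; have := szego_denom_neq0 t l1.
by have := circle_pt_neq0 t => z0 d0 z1; field; rewrite z0 d0 z1.
Qed.

(** Write k for the kernel and b for the Blaschke factor. Then k = 1 + l^* (b + l k), where b is
    orthogonal to k and 1 has inner product 1 with k, so the squared norm N of k solves N = 1 +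
    |l|^2 N. *)
Lemma inner_szego l : `|l| < 1 -> inner (szego l) (szego l) = (1 - `|l| ^+ 2)^-1.
Proof.
move=> l1; have bs := circle_bounded_szego l1; have Ls := circle_bounded_L2 bs.
have L1 : L2 (fun=> 1 : C) := Hardy2_L2 (Hardy2_cst 1).
have Hs : Hardy2 (szego l).
  by apply: eq_Hardy2 (Hardy2_szegoM l1 (Hardy2_cst 1)) => t; rewrite mulr1.
have s1 : inner (szego l) (fun=> 1) = 1.
  transitivity (inner (fun z => 1 + l^* * (z * szego l z)) (fun z : C => z ^ 0)).
    apply: eq_inner => // t; rewrite /szego; have := szego_denom_neq0 t l1.
    by move=> d0; field.
  have LE := @L2_exprz 0.
  rewrite innerDl ?innerZl //; [|exact: L2_mulz|exact/L2Z/L2_mulz].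
  rewrite inner_mulz -[inner (szego l) _]/(fourier _ _) (proj2 Hs) // mulr0 addr0.
  exact: (inner_exprz 0 0).
have N : inner (szego l) (szego l) = 1 + `|l| ^+ 2 * inner (szego l) (szego l).
  transitivity (inner (fun z => 1 + l^* * (blaschke_factor l z * 1 + l * szego l z)) (szego l)).
    apply: eq_inner => // t; rewrite /szego /blaschke_factor; have := szego_denom_neq0 t l1.
    by move=> d0; field.
  have L3 : L2 (fun z => blaschke_factor l z * 1) := Hardy2_L2 (Hardy2_factorM l1 (Hardy2_cst 1)).
  rewrite innerDl ?innerZl ?innerDl ?innerZl //; [|exact: L2Z|exact/L2D/L2Z|exact/L2Z/L2D/L2Z].
  rewrite inner_factor_szego //; last exact: Hardy2_cst.
  rewrite (innerC Ls L1) s1 rmorph1 add0r normCK; congr (_ + _); ring.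
have n0 : 1 - `|l| ^+ 2 != 0.
  by rewrite subr_eq0 eq_sym lt_eqF // exprn_ilt1.
by apply: (mulfI n0); rewrite mulfV // mulrBl mul1r {1}N addrK.
Qed.

(* The recursion [(z - l) q = f] propagates the vanishing of the Fourier
   coefficient of [q] at [-1], which is [inner f (szego l)], to all negative
   indices. *)
Lemma Hardy2_factor_div l f : `|l| < 1 -> Hardy2 f -> inner f (szego l) = 0 ->
  exists2 g, Hardy2 g & forall t, f (circle_pt t) =
    blaschke_factor l (circle_pt t) * g (circle_pt t).
Proof.
move=> l1 [Lf Hf] fs0; pose q z := (z - l)^-1 * f z.
have Lq : L2 q.
  apply: circle_boundedM_L2 => //; apply: (@circle_boundedV _ _ (1 - `|l|)).
  - by rewrite subr_gt0.
  - by move=> t; apply: le_trans (lerB_dist _ _); rewrite norm_circle_pt.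
  - exact: circle_boundedB circle_bounded_id (circle_bounded_cst _).
have Hq : Hardy2 q.
  split=> // n n0; have -> : n = - (absz n).-1.+1%:Z by lia.
  elim: (absz n).-1 => [|k IH].
    rewrite -fs0; apply: eq_circle_mean => t; rewrite -[_ ^ _]/(_^-1).
    rewrite /szego !conjV conj_szego_denom conj_circle_pt invrK invf_div /q.
    by rewrite mulrC mulrA [LHS]mulrC.
  have := Hf (- k.+1%:Z) erefl.
  have -> : fourier f (- k.+1%:Z) =
      inner (fun z => z * q z - l * q z) (fun z : C => z ^ (- k.+1%:Z)).
    apply: eq_inner => // t; rewrite /q -mulrBl mulrA divff ?mul1r //.
    exact: circle_pt_subr_neq0.
  have LE := L2_exprz (- k.+1%:Z).
  rewrite innerBl ?innerZl //; [|exact: L2_mulz|exact: L2Z].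
  rewrite -[inner q _]/(fourier q _) IH mulr0 subr0 inner_mulz => <-.
  by apply: eq_inner => // t; congr (_ ^ _); lia.
exists (fun z => q z - l^* * (z * q z)).
  exact/Hardy2B/Hardy2Z/Hardy2_mulz.
move=> t; rewrite /blaschke_factor /q.
have := circle_pt_subr_neq0 t l1; have := szego_denom_neq0 t l1.
by move=> *; field; apply/andP.
Qed.

Lemma inner_unimodularM (u f g : C -> C) : (forall t, `|u (circle_pt t)| = 1) ->
  inner (fun z => u z * f z) (fun z => u z * g z) = inner f g.
Proof.
move=> u1; apply: eq_circle_mean => t; rewrite rmorphM /= mulrACA -normCK u1.
by rewrite expr1n mul1r.
Qed.

Lemma Hardy2_szego l : `|l| < 1 -> Hardy2 (szego l).
Proof.
by move=> l1; apply: eq_Hardy2 (Hardy2_szegoM l1 (Hardy2_cst 1)) => t; rewrite mulr1.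
Qed.

End HardySpace.

(** * The Takenaka-Malmquist system of a sequence of points of the disc *)

Section TakenakaMalmquist.
Context {R : realType}.
Local Notation C := R[i].
Implicit Types (f g h : C -> C) (t : R).
Variable p : nat -> C.
Hypothesis p_lt1 : forall i, `|p i| < 1.

Definition blaschke_range (i j : nat) : C -> C :=
  fun z => \prod_(i <= k < j) blaschke_factor (p k) z.

Definition takenaka_malmquist (i : nat) : C -> C :=
  fun z => sqrtC (1 - `|p i| ^+ 2) * (szego (p i) z * blaschke_range 0 i z).
Local Notation e := takenaka_malmquist.

Lemma circle_bounded_range i j : circle_bounded (blaschke_range i j).
Proof. by apply: circle_bounded_prod => k; exact: circle_bounded_factor. Qed.

Lemma norm_blaschke_range i j t : `|blaschke_range i j (circle_pt t)| = 1.
Proof.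
by rewrite normr_prod big1 // => k _; exact: norm_blaschke_factor.
Qed.

Lemma blaschke_range_cat i j z : (i < j)%N ->
  blaschke_range 0 j z =
  blaschke_range 0 i z * (blaschke_factor (p i) z * blaschke_range i.+1 j z).
Proof.
by move=> ij; rewrite /blaschke_range (big_cat_nat (n := i)) //=; [|exact: ltnW];
  rewrite [in X in _ * X = _]big_ltn.
Qed.

Lemma Hardy2_rangeM i j f : Hardy2 f -> Hardy2 (fun z => blaschke_range i j z * f z).
Proof.
move=> Hf; rewrite /blaschke_range; elim: (index_iota i j) => [|k r IH].
  by apply: eq_Hardy2 Hf => t; rewrite big_nil mul1r.
apply: eq_Hardy2 (Hardy2_factorM (p_lt1 k) IH) => t.
by rewrite big_cons mulrA.
Qed.

Lemma takenaka_malmquistE i z :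
  e i z = blaschke_range 0 i z * (sqrtC (1 - `|p i| ^+ 2) * szego (p i) z).
Proof. by rewrite /e; ring. Qed.

Lemma circle_bounded_takenaka_malmquist i : circle_bounded (e i).
Proof.
apply: circle_boundedM (circle_bounded_cst _) _.
exact: circle_boundedM (circle_bounded_szego _) (circle_bounded_range _ _).
Qed.

Lemma Hardy2_takenaka_malmquist i : Hardy2 (e i).
Proof.
apply: eq_Hardy2 (Hardy2_rangeM 0 i (Hardy2Z (sqrtC (1 - `|p i| ^+ 2)) (Hardy2_szego (p_lt1 i)))) => t.
by rewrite takenaka_malmquistE.
Qed.

(** The unimodular factor [blaschke_range 0 i] is common to both arguments and cancels. There
    remains a Hardy function with a factor vanishing at [p i], paired with a multiple of the kernel
    at [p i]. *)
Lemma inner_range_takenaka_malmquist i j h : (i < j)%N -> Hardy2 h ->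
  inner (fun z => blaschke_range 0 j z * h z) (e i) = 0.
Proof.
move=> ij Hh; have Hh' := Hardy2_rangeM i.+1 j Hh.
have LF := Hardy2_L2 (Hardy2_factorM (p_lt1 i) Hh').
have LS := Hardy2_L2 (Hardy2_szego (p_lt1 i)).
transitivity (inner
  (fun z => blaschke_range 0 i z * (blaschke_factor (p i) z * (blaschke_range i.+1 j z * h z)))
  (fun z => blaschke_range 0 i z * (sqrtC (1 - `|p i| ^+ 2) * szego (p i) z))).
  apply: eq_inner => t; last exact: takenaka_malmquistE.
  by rewrite (blaschke_range_cat _ ij) !mulrA.
rewrite inner_unimodularM; last exact: norm_blaschke_range.
by rewrite innerZr // inner_factor_szego ?mulr0.
Qed.

Lemma takenaka_malmquist_orthonormal i j : inner (e i) (e j) = (i == j)%:R.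
Proof.
have Le k : L2 (e k) := Hardy2_L2 (Hardy2_takenaka_malmquist k).
have orth k l : (l < k)%N -> inner (e k) (e l) = 0.
  move=> lk; rewrite -(inner_range_takenaka_malmquist lk
    (Hardy2Z (sqrtC (1 - `|p k| ^+ 2)) (Hardy2_szego (p_lt1 k)))).
  by apply: eq_inner => // t; rewrite takenaka_malmquistE.
have [ij|ij|->] := ltngtP i j.
- by rewrite (innerC (Le j)) // orth // rmorph0.
- by rewrite orth.
have LS := Hardy2_L2 (Hardy2_szego (p_lt1 j)); set s := sqrtC (1 - `|p j| ^+ 2).
transitivity (inner (fun z => blaschke_range 0 j z * (s * szego (p j) z))
    (fun z => blaschke_range 0 j z * (s * szego (p j) z))).
  by apply: eq_inner => t; exact: takenaka_malmquistE.
rewrite inner_unimodularM; last exact: norm_blaschke_range.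
have n0 : 0 < 1 - `|p j| ^+ 2 by rewrite subr_gt0 exprn_ilt1.
rewrite innerZl ?innerZr //; last exact: L2Z.
rewrite inner_szego // mulrA -normCK ger0_norm ?sqrtC_ge0 ?ltW //.
by rewrite sqrtCK divff // gt_eqF.
Qed.

(** Successive division: a multiple of the kernel at [p N] is subtracted from the current quotient g
    to make it vanish at [p N], and the Blaschke factor is then divided out. *)
Lemma takenaka_malmquist_decomposition N f : Hardy2 f ->
  exists (c : nat -> C) g, Hardy2 g /\ forall t,
    f (circle_pt t) = \sum_(i < N) c i * e i (circle_pt t) +
      blaschke_range 0 N (circle_pt t) * g (circle_pt t).
Proof.
move=> Hf; elim: N => [|N [c [g [Hg fE]]]].
  exists (fun=> 0), f; split => // t.
  by rewrite big_ord0 add0r /blaschke_range big_geq // mul1r.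
have n0 : 0 < 1 - `|p N| ^+ 2 by rewrite subr_gt0 exprn_ilt1.
pose s := sqrtC (1 - `|p N| ^+ 2); have s0 : s != 0 by rewrite sqrtC_eq0 gt_eqF.
(* The value of g at [p N] divided by the value 1 / (1 - |p N|^2) of the kernel there. *)
pose b := inner g (szego (p N)) * (1 - `|p N| ^+ 2).
have HS := Hardy2_szego (p_lt1 N).
have [] := @Hardy2_factor_div _ (p N) (fun z => g z - b * szego (p N) z).
- exact: p_lt1.
- exact/Hardy2B/Hardy2Z.
- have LS := Hardy2_L2 HS; have Lg := Hardy2_L2 Hg.
  rewrite innerBl ?innerZl //; last exact: L2Z.
  by rewrite inner_szego // /b mulfK ?subrr // gt_eqF.
move=> g' Hg' gE.
exists (fun i => if i == N then b / s else c i), g'; split => // t.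
rewrite big_ord_recr /= eqxx fE -addrA; congr (_ + _).
  by apply: eq_bigr => i _; rewrite (ltn_eqF (ltn_ord i)).
rewrite /blaschke_range big_nat_recr //= -/(blaschke_range 0 N _).
rewrite -[_ * g' _]mulrA -(gE t) takenaka_malmquistE -/s.
by field.
Qed.

Lemma model_space_takenaka_malmquist N i : (i < N)%N ->
  model_space (blaschke_range 0 N) (e i).
Proof.
move=> iN; split; first exact: Hardy2_takenaka_malmquist.
move=> h Hh; have H := inner_range_takenaka_malmquist iN Hh.
by rewrite (innerC (Hardy2_L2 (Hardy2_rangeM 0 N Hh))) ?H ?rmorph0 //;
  exact/Hardy2_L2/Hardy2_takenaka_malmquist.
Qed.

(** The remainder r of the decomposition is in theta H^2, to which f and all [e i] with i < N are
    orthogonal. Being f minus a combination of these, r is orthogonal to itself, hence 0 almost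
    everywhere. *)
Lemma model_space_span N f : model_space (blaschke_range 0 N) f ->
  exists c : 'I_N -> C, ae_circle (fun z => f z = \sum_(i < N) c i * e i z).
Proof.
move=> [Hf fN]; have [c [g [Hg fE]]] := takenaka_malmquist_decomposition N Hf.
exists (fun i => c i); pose r z := blaschke_range 0 N z * g z.
have Hr : Hardy2 r := Hardy2_rangeM 0 N Hg; have Lr := Hardy2_L2 Hr.
have Le i : L2 (fun z => c i * e i z).
  exact/L2Z/Hardy2_L2/Hardy2_takenaka_malmquist.
have Lf := Hardy2_L2 Hf.
have LS : L2 (fun z => \sum_(i < N) c i * e i z) by apply: L2_sum => i; exact: Le.
have rr : inner r r = 0.
  transitivity (inner (fun z => f z - \sum_(i < N) c i * e i z) r).
    by apply: eq_inner => // t; rewrite fE addrAC subrr add0r.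
  rewrite innerBl // fN // inner_suml // ?big1 ?subrr // => i _.
  rewrite innerZl //; last exact/Hardy2_L2/Hardy2_takenaka_malmquist.
  by rewrite (proj2 (model_space_takenaka_malmquist (ltn_ord i))) // mulr0.
apply: ae_circleS (inner_eq0 Lr rr) => t r0.
by rewrite fE -/(r _) r0 addr0.
Qed.

End TakenakaMalmquist.

(** * Orthonormal bases of spaces of representatives *)

Section OrthonormalBasis.
Context {R : realType}.
Local Notation C := R[i].
Implicit Types (f g h : C -> C) (K : set (C -> C)).

(** K is a bare set of representatives, so the two facts about it that coordinates rely on,
    inclusion in [L2] and stability under combinations of e, are recorded with the basis. *)
Definition orthonormal_basis K N (e : 'I_N -> C -> C) :=
  [/\ forall i, K (e i), forall f, K f -> L2 f,
      forall c : 'I_N -> C, K (fun z => \sum_(i < N) c i * e i z),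
      forall i j, inner (e i) (e j) = (i == j)%:R &
      forall f, K f -> exists c : 'I_N -> C,
        ae_circle (fun z => f z = \sum_(i < N) c i * e i z)].

Lemma orthonormal_coef N (e : 'I_N -> C -> C) f (c : 'I_N -> C) :
  (forall i, L2 (e i)) -> (forall i j, inner (e i) (e j) = (i == j)%:R) ->
  L2 f -> ae_circle (fun z => f z = \sum_(i < N) c i * e i z) ->
  forall i, inner f (e i) = c i.
Proof.
move=> Le oe Lf fE i.
have LS : L2 (fun z => \sum_(i < N) c i * e i z) by apply: L2_sum => j; exact: L2Z.
rewrite (ae_inner Lf LS (Le i) (Le i) fE (ae_circleW _)) //.
rewrite inner_suml //; last by move=> j; exact: L2Z.
rewrite (bigD1 i) //= innerZl // oe eqxx mulr1 big1 ?addr0 // => j ji.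
by rewrite innerZl // oe (negPf ji) mulr0.
Qed.

Lemma orthonormal_basis_is_basis K N (e : 'I_N -> C -> C) :
  orthonormal_basis K e -> is_basis K e.
Proof.
move=> [Ke KL _ oe Se]; split => // c c0 i.
have Le j : L2 (e j) := KL _ (Ke j).
have L0 : L2 (fun=> 0 : C) := Hardy2_L2 (Hardy2_cst 0).
rewrite -(orthonormal_coef Le oe L0 (c := c)); last first.
  by apply: ae_circleS c0 => t ->.
rewrite -[RHS](mul0r (inner (e i) (e i))) -innerZl //.
by apply: eq_inner => // t; rewrite mul0r.
Qed.

Lemma takenaka_malmquist_basis (p : nat -> C) N : (forall i, `|p i| < 1) ->
  orthonormal_basis (model_space (blaschke_range p 0 N))
    (fun i : 'I_N => takenaka_malmquist p i).
Proof.
move=> p1; split.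
- by move=> i; exact: model_space_takenaka_malmquist.
- by move=> f [/Hardy2_L2].
- move=> c; have H (i : 'I_N) : Hardy2 (fun z => c i * takenaka_malmquist p i z).
    exact/Hardy2Z/Hardy2_takenaka_malmquist.
  have HS : Hardy2 (fun z => \sum_(i < N) c i * takenaka_malmquist p i z).
    by apply: (Hardy2_sum _ (F := fun i z => _)) => i; exact: H.
  split => // h Hh; have Lh := Hardy2_L2 (Hardy2_rangeM p1 0 N Hh).
  have Le i := Hardy2_L2 (Hardy2_takenaka_malmquist p1 i).
  rewrite inner_suml // => [|i]; last exact: L2Z.
  rewrite big1 // => i _; rewrite innerZl //.
  by rewrite (proj2 (model_space_takenaka_malmquist p1 (ltn_ord i))) ?mulr0.
- by move=> i j; exact: takenaka_malmquist_orthonormal.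
- by move=> f; exact: model_space_span.
Qed.

End OrthonormalBasis.

(** The bases to be compared come with their own sizes, which the two inverse relations force to
    coincide. P then intertwines the characteristic matrices, and its nonzero determinant
    cancels. *)
Lemma char_poly_similar (F : fieldType) N N' (A : 'M[F]_N) (B : 'M[F]_N')
    (P : 'M[F]_(N, N')) (Q : 'M[F]_(N', N)) :
  P *m Q = 1%:M -> Q *m P = 1%:M -> A *m P = P *m B -> char_poly A = char_poly B.
Proof.
move=> PQ QP; have NN : N = N' by apply/eqP; rewrite eqn_leq (mulmx1_min QP) (mulmx1_min PQ).
case: N' / NN B P Q PQ QP => B P Q _ QP AP; pose P' := map_mx polyC P.
have H : char_poly_mx A *m P' = P' *m char_poly_mx B.
  by rewrite /char_poly_mx mulmxBl mulmxBr -!map_mxM AP mul_scalar_mx mul_mx_scalar.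
have dP : \det P' != 0.
  rewrite det_map_mx polyC_eq0; apply/eqP => d0.
  have := congr1 determinant QP; rewrite det_mulmx d0 mulr0 det1 => /eqP.
  by rewrite eq_sym oner_eq0.
by apply: (mulIf dP); rewrite /char_poly -det_mulmx H det_mulmx mulrC.
Qed.

(** * Matrices of operators defined by choice, and their spectra *)

Section MatrixOfOperator.
Context {R : realType}.
Local Notation C := R[i].
Implicit Types (f g h : C -> C) (K : set (C -> C)) (T : (C -> C) -> C -> C).

(** An operator obtained by choice may depend on the representative and be linear only almost
    everywhere. The matrix is therefore asked to describe the image of every representative, and
    stability of K is included so that operators can be composed. *)
Definition is_operator_matrix K N (e : 'I_N -> C -> C) T (A : 'M[C]_N) :=
  forall g (c : 'cV[C]_N), K g -> ae_circle (fun z => g z = \sum_(i < N) c i 0 * e i z) ->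
    K (T g) /\ ae_circle (fun z => T g z = \sum_(i < N) (A *m c) i 0 * e i z).

Variables (K : set (C -> C)) (N : nat) (e : 'I_N -> C -> C).
Hypothesis be : orthonormal_basis K e.

Let Ke : forall i, K (e i). Proof. by case: be. Qed.
Let KL : forall f, K f -> L2 f. Proof. by case: be. Qed.
Let Le i : L2 (e i). Proof. exact/KL/Ke. Qed.
Let KS : forall c : 'I_N -> C, K (fun z => \sum_(i < N) c i * e i z).
Proof. by case: be. Qed.
Let oe : forall i j, inner (e i) (e j) = (i == j)%:R. Proof. by case: be. Qed.
Let LS (c : 'I_N -> C) : L2 (fun z => \sum_(i < N) c i * e i z).
Proof. exact/KL/KS. Qed.

Lemma orthonormal_span g : K g -> exists c : 'cV[C]_N,
  ae_circle (fun z => g z = \sum_(i < N) c i 0 * e i z).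
Proof.
move=> Kg; have [_ _ _ _ /(_ g Kg)[c cE]] := be; exists (\col_i c i).
by apply: ae_circleS cE => t ->; apply: eq_bigr => i _; rewrite mxE.
Qed.

Lemma ae_inner_l f g h : L2 f -> L2 g -> L2 h -> ae_circle (fun z => f z = g z) ->
  inner f h = inner g h.
Proof. by move=> Lf Lg Lh fg; apply: ae_inner => //; exact: ae_circleW. Qed.

Lemma ae_inner_r f g h : L2 f -> L2 g -> L2 h -> ae_circle (fun z => f z = g z) ->
  inner h f = inner h g.
Proof. by move=> Lf Lg Lh fg; apply: ae_inner => //; exact: ae_circleW. Qed.

Lemma inner_basis_suml (c : 'I_N -> C) h : L2 h ->
  inner (fun z => \sum_(i < N) c i * e i z) h = \sum_(i < N) c i * inner (e i) h.
Proof.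
move=> Lh; rewrite inner_suml // => [|i]; last exact: L2Z.
by apply: eq_bigr => i _; rewrite innerZl.
Qed.

Lemma inner_basis_sumr (c : 'I_N -> C) h : L2 h ->
  inner h (fun z => \sum_(i < N) c i * e i z) = \sum_(i < N) (c i)^* * inner h (e i).
Proof.
move=> Lh; rewrite inner_sumr // => [|i]; last exact: L2Z.
by apply: eq_bigr => i _; rewrite innerZr.
Qed.

(** The explicit sum [p0] shows that there is something to choose; whichever element is chosen, its
    orthogonality condition tested on [e i] fixes its coordinates. *)
Lemma proj_orthonormal f : L2 f -> K (Defs.proj K f) /\
  ae_circle (fun z => Defs.proj K f z = \sum_(i < N) inner f (e i) * e i z).
Proof.
move=> Lf; rewrite /Defs.proj; set P := (X in xget _ X).
pose p0 z := \sum_(i < N) inner f (e i) * e i z.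
have Lp0 : L2 p0 by exact: LS.
have Pp0 : P p0.
  split; first exact: KS.
  move=> k Kk; have [c cE] := orthonormal_span Kk; have Lk := KL Kk.
  rewrite innerBl // (ae_inner_r Lk (LS _) Lf cE) (ae_inner_r Lk (LS _) Lp0 cE).
  rewrite !inner_basis_sumr // -sumrB big1 // => i _; rewrite -mulrBr.
  rewrite inner_basis_suml // (bigD1 i) //= oe eqxx mulr1 big1 ?addr0 ?subrr ?mulr0 //.
  by move=> j ji; rewrite oe (negPf ji) mulr0.
have [Kp Hp] : P (xget (fun=> 0) P) by apply: xgetPex; exists p0.
split => //; have [c cE] := orthonormal_span Kp; have Lp := KL Kp.
have cI := orthonormal_coef Le oe Lp cE.
apply: ae_circleS cE => t ->; apply: eq_bigr => i _; congr (_ * _).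
by rewrite -cI; apply/esym/eqP; rewrite -subr_eq0 -innerBl //; apply/eqP/Hp.
Qed.

(** Boundedness of the basis keeps the products [f * e j] in [L2] for unbounded f. An arbitrary g in
    K inherits this because it equals a combination of the [e j] almost everywhere. *)
Lemma toeplitz_matrix f : L2 f -> (forall i, circle_bounded (e i)) ->
  is_operator_matrix K e (toeplitz f K) (\matrix_(i, j) inner (fun z => f z * e j z) (e i)).
Proof.
move=> Lf bdd g c Kg gE; have Lg := KL Kg.
have Lfe j : L2 (fun z => f z * e j z).
  by apply: eq_L2 (circle_boundedM_L2 (bdd j) Lf) => t; rewrite mulrC.
have LfS : L2 (fun z => \sum_(j < N) c j 0 * (f z * e j z)).
  by apply: L2_sum => j; exact: L2Z.
have fgE : ae_circle (fun z => f z * g z = \sum_(j < N) c j 0 * (f z * e j z)).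
  by apply: ae_circleS gE => t ->; rewrite mulr_sumr; apply: eq_bigr => j _; rewrite mulrCA.
have Lfg : L2 (fun z => f z * g z).
  by apply: ae_L2 LfS fgE; apply: circle_measurableM; exact: L2_measurable.
have [Kp pE] := proj_orthonormal Lfg; split => //.
apply: ae_circleS pE => t; rewrite /toeplitz => ->.
apply: eq_bigr => i _; congr (_ * _).
rewrite (ae_inner_l Lfg LfS (Le i) fgE) inner_suml // => [|j]; last exact: L2Z.
by rewrite !mxE; apply: eq_bigr => j _; rewrite innerZl // mxE mulrC.
Qed.

Lemma adjoint_matrix T A : is_operator_matrix K e T A ->
  is_operator_matrix K e (adjoint K T) (A ^t*)%sesqui.
Proof.
move=> TA h c Kh hE; have Lh := KL Kh.
pose b := (A ^t*)%sesqui *m c; pose p0 z := \sum_(i < N) b i 0 * e i z.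
rewrite /adjoint; set P := (X in xget _ X).
have innerT g (d : 'cV[C]_N) : K g -> ae_circle (fun z => g z = \sum_(i < N) d i 0 * e i z) ->
    inner (T g) h = \sum_(i < N) d i 0 * (b i 0)^*.
  move=> Kg gE; have [KT TE] := TA g d Kg gE.
  rewrite (ae_inner_l (KL KT) (LS _) Lh TE) inner_basis_suml //.
  transitivity (\sum_(i < N) (A *m d) i 0 * (c i 0)^*).
    apply: eq_bigr => i _; rewrite (ae_inner_r Lh (LS _) (Le i) hE).
    rewrite inner_basis_sumr // (bigD1 i) //= oe eqxx mulr1 big1 ?addr0 //.
    by move=> j ji; rewrite oe eq_sym (negPf ji) mulr0.
  under eq_bigr do rewrite mxE mulr_suml.
  rewrite exchange_big /=; apply: eq_bigr => j _; rewrite mxE rmorph_sum mulr_sumr.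
  apply: eq_bigr => i _; rewrite !mxE rmorphM /= conjCK; ring.
have Pp0 : P p0.
  split; first exact: KS.
  move=> g Kg; have [d gE] := orthonormal_span Kg; rewrite (innerT g d) //.
  have Lg := KL Kg; rewrite (ae_inner_l Lg (LS _) (LS _) gE) inner_basis_suml;
    last exact: (LS (fun i => b i 0)).
  apply: eq_bigr => i _; congr (_ * _); rewrite inner_basis_sumr //.
  rewrite (bigD1 i) //= oe eqxx mulr1 big1 ?addr0 //.
  by move=> j ji; rewrite oe eq_sym (negPf ji) mulr0.
have [Kp Hp] : P (xget (fun=> 0) P) by apply: xgetPex; exists p0.
split => //; have [d dE] := orthonormal_span Kp; have Lp := KL Kp.
have dI := orthonormal_coef Le oe Lp dE.
apply: ae_circleS dE => t ->; apply: eq_bigr => i _; congr (_ * _).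
(* The adjoint identity is tested on [e i], whose coordinates form a unit vector, to read off the
   coordinate i of the chosen element. *)
rewrite -dI (innerC (Le i)) // -Hp // (innerT (e i) (\col_j (j == i)%:R)) //; last first.
  apply: ae_circleW => t'; rewrite (bigD1 i) //= mxE eqxx mul1r big1 ?addr0 //.
  by move=> j ji; rewrite mxE (negPf ji) mul0r.
rewrite (bigD1 i) //= mxE eqxx mul1r big1 ?addr0 ?conjCK //.
by move=> j ji; rewrite mxE (negPf ji) mul0r.
Qed.

Lemma comp_matrix T1 T2 A1 A2 : is_operator_matrix K e T1 A1 ->
  is_operator_matrix K e T2 A2 -> is_operator_matrix K e (T1 \o T2) (A1 *m A2).
Proof.
move=> H1 H2 g c Kg gE; have [K2 E2] := H2 g c Kg gE.
by rewrite -mulmxA; exact: H1.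
Qed.

(** Each basis is expanded in the other. Substituting one expansion into the other gives P Q = 1 by
    orthonormality of e, and Q P = 1 by freeness of [e']. *)
Lemma basis_change N' (e' : 'I_N' -> C -> C) : is_basis K e' ->
  exists (P : 'M[C]_(N, N')) (Q : 'M[C]_(N', N)),
    [/\ forall j, ae_circle (fun z => e' j z = \sum_(i < N) P i j * e i z),
        P *m Q = 1%:M & Q *m P = 1%:M].
Proof.
move=> [Ke' free' span'].
have [P PE] : exists P : 'M[C]_(N, N'), forall j,
    ae_circle (fun z => e' j z = \sum_(i < N) P i j * e i z).
  have /choice[f fE] j := orthonormal_span (Ke' j).
  exists (\matrix_(i, j) f j i 0) => j; apply: ae_circleS (fE j) => t ->.
  by apply: eq_bigr => i _; rewrite mxE.
have [Q QE] : exists Q : 'M[C]_(N', N), forall j,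
    ae_circle (fun z => e j z = \sum_(i < N') Q i j * e' i z).
  have /choice[f fE] j := span' _ (Ke j).
  exists (\matrix_(i, j) f j i) => j; apply: ae_circleS (fE j) => t ->.
  by apply: eq_bigr => i _; rewrite mxE.
have allP := @ae_circle_forall _ _ (enum 'I_N') _ PE.
have allQ := @ae_circle_forall _ _ (enum 'I_N) _ QE.
exists P, Q; split => //.
- apply/matrixP => i j.
  have E : ae_circle (fun z => e j z = \sum_(i < N) (P *m Q) i j * e i z).
    apply: ae_circleS (ae_circleI (QE j) allP) => t [-> H].
    under eq_bigr => k _ do rewrite H ?mem_enum // mulr_sumr.
    rewrite exchange_big /=; apply: eq_bigr => k _; rewrite mxE mulr_suml.
    by apply: eq_bigr => l _; ring.
  by rewrite -(orthonormal_coef Le oe (Le j) E i) oe mxE eq_sym.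
- apply/matrixP => i j; apply/eqP; rewrite -subr_eq0; apply/eqP.
  apply: (free' (fun k => (Q *m P) k j - (1%:M : 'M[C]_N') k j)).
  apply: ae_circleS (ae_circleI (PE j) allQ) => t [H1 H2].
  under eq_bigr do rewrite mulrBl; rewrite sumrB [X in _ - X](bigD1 j) //= mxE eqxx mul1r.
  rewrite [X in _ - (_ + X)]big1 => [|k kj]; last by rewrite mxE (negPf kj) mul0r.
  apply/eqP; rewrite addr0 subr_eq0 H1; apply/eqP.
  under [RHS]eq_bigr => k _ do rewrite H2 ?mem_enum // mulr_sumr.
  rewrite exchange_big /=; apply: eq_bigr => k _; rewrite mxE mulr_suml.
  by apply: eq_bigr => l _; ring.
Qed.

Lemma subspace_dimE : subspace_dim K = N.
Proof.
rewrite /subspace_dim; set S := (X in xget _ X).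
have : S (xget 0%N S).
  by apply: xgetPex; exists N, e; exact: orthonormal_basis_is_basis.
move=> [e' /basis_change[P [Q [_ PQ QP]]]].
by apply/eqP; rewrite eqn_leq (mulmx1_min QP) (mulmx1_min PQ).
Qed.

(** The list is chosen together with an unknown basis, but the characteristic polynomial is the same
    in all bases and determines its roots up to order. The basis e itself shows that an admissible
    list exists. *)
Lemma eigenvalues_perm T A (s : seq C) : is_operator_matrix K e T A ->
  char_poly A = \prod_(x <- s) ('X - x%:P) -> perm_eq (eigenvalues K T) s.
Proof.
move=> TA sA; have key s' : is_eigenvalues K T s' -> perm_eq s' s.
  move=> [N' [e' [A' [be' TA' sA']]]].
  have [P [Q [PE PQ QP]]] := basis_change be'.
  apply: prod_XsubC_eq; rewrite -sA' -sA; apply/esym.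
  apply: (char_poly_similar PQ QP); apply/matrixP => i j.
  have Kj : K (e' j) by case: be' => [+ _ _]; apply.
  (* Column j of A P and column j of P A' both hold the coordinates of [T (e' j)] in e, which are
     unique; hence A P = P A'. *)
  have [|KT TE] := TA (e' j) (\col_i P i j) Kj.
    by apply: ae_circleS (PE j) => t ->; apply: eq_bigr => k _; rewrite mxE.
  rewrite -[LHS](_ : (A *m \col_k P k j) i 0 = _); last first.
    by rewrite !mxE; apply: eq_bigr => k _; rewrite mxE.
  rewrite -(orthonormal_coef Le oe (KL KT) TE i).
  apply: (@orthonormal_coef _ _ e _ (fun k => (P *m A') k j) Le oe (KL KT)).
  have allP := @ae_circle_forall _ _ (enum 'I_N') _ PE.
  apply: ae_circleS (ae_circleI (TA' j) allP) => t [-> H].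
  under eq_bigr => k _ do rewrite H ?mem_enum // mulr_sumr.
  rewrite exchange_big /=; apply: eq_bigr => k _; rewrite mxE mulr_suml.
  by apply: eq_bigr => l _; ring.
apply: key; rewrite /eigenvalues; set S := (X in xget _ X).
apply: xgetPex; exists s; exists N, e, A; split => //.
  exact: orthonormal_basis_is_basis.
move=> j; have [|_] := TA (e j) (\col_i (i == j)%:R) (Ke j).
  apply: ae_circleW => t'; rewrite (bigD1 j) //= mxE eqxx mul1r big1 ?addr0 //.
  by move=> k kj; rewrite mxE (negPf kj) mul0r.
apply: ae_circleS => t ->; apply: eq_bigr => i _; congr (_ * _).
rewrite mxE (bigD1 j) //= mxE eqxx mulr1 big1 ?addr0 //.
by move=> k kj; rewrite mxE (negPf kj) mulr0.
Qed.

End MatrixOfOperator.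

(** * Spectral weights of approximate eigenvectors and singular vectors *)

Section SpectralDefect.
Local Open Scope sesquilinear_scope.
Context {C : numClosedFieldType}.

Definition sqr_norm N (v : 'cV[C]_N) : C := \sum_(i < N) `|v i 0| ^+ 2.

Lemma sqr_normE N (v : 'cV[C]_N) : sqr_norm v = (v ^t* *m v) 0 0.
Proof. by rewrite mxE; apply: eq_bigr => i _; rewrite !mxE normCK mulrC. Qed.

Lemma sqr_norm_ge0 N (v : 'cV[C]_N) : 0 <= sqr_norm v.
Proof. by apply: sumr_ge0 => i _; rewrite exprn_ge0. Qed.

Lemma adjmxM m n p (A : 'M[C]_(m, n)) (B : 'M[C]_(n, p)) :
  (A *m B) ^t* = B ^t* *m A ^t*.
Proof. by rewrite trmx_mul map_mxM. Qed.

Lemma adjmxB m n (A B : 'M[C]_(m, n)) : (A - B) ^t* = A ^t* - B ^t*.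
Proof. by apply/matrixP => i j; rewrite !mxE rmorphB. Qed.

Lemma adjmxK m n (A : 'M[C]_(m, n)) : A ^t* ^t* = A.
Proof. exact: trmxCK. Qed.

Lemma sqr_norm_unitary N (P : 'M[C]_N) (v : 'cV[C]_N) : P \is unitarymx ->
  sqr_norm (P *m v) = sqr_norm v.
Proof.
move=> uP; rewrite !sqr_normE adjmxM -mulmxA [P ^t* *m _]mulmxA.
have /unitarymxP : P ^t* \is unitarymx by rewrite trmxC_unitary.
by rewrite adjmxK => ->; rewrite mul1mx.
Qed.

Lemma hermitian_spectral N (A : 'M[C]_N) : A ^t* = A ->
  exists (P : 'M[C]_N) (d : 'I_N -> C), [/\ P \is unitarymx,
    P *m A = diag_mx (\row_i d i) *m P, forall i, d i \is Num.real &
    char_poly A = \prod_(i < N) ('X - (d i)%:P)].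
Proof.
move=> AA; have hA : A \is hermsymmx.
  by apply/is_hermitianmxP; rewrite expr0 scale1r.
have nA := hermitian_normalmx hA.
have /orthomx_spectralP := nA; set P := spectralmx A; set sp := spectral_diag A => E.
have uP : P \is unitarymx := spectral_unitarymx A.
have Pu := spectral_unit A; exists P, (fun i => sp 0 i).
have -> : \row_i sp 0 i = sp by apply/rowP => i; rewrite mxE.
have PA : P *m A = diag_mx sp *m P by rewrite {1}E !mulmxA mulmxV // mul1mx.
split => //.
- by move=> i; have /mxOverP := hermitian_spectral_diag_real hA; apply.
- rewrite -(char_poly_similar (mulmxV Pu) (mulVmx Pu) (A := diag_mx sp) (B := A)) //.
  rewrite char_poly_trig ?diag_mx_is_trig //.
  by apply: eq_bigr => i _; rewrite mxE eqxx mulr1n.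
Qed.

(** P preserves the norm and turns A v - y v into the vector with entries (d_i - y) (P v)_i. *)
Lemma hermitian_defect N (A P : 'M[C]_N) (d : 'I_N -> C) (v : 'cV[C]_N) (y : C) :
  P \is unitarymx -> P *m A = diag_mx (\row_i d i) *m P ->
  \sum_(i < N) `|d i - y| ^+ 2 * `|(P *m v) i 0| ^+ 2 = sqr_norm (A *m v - y *: v).
Proof.
move=> uP PA; rewrite -(sqr_norm_unitary _ uP) mulmxBr -scalemxAr mulmxA PA.
apply: eq_bigr => i _; rewrite -exprMn -normrM -mulmxA mul_diag_mx !mxE.
by rewrite mulrBl.
Qed.

(** Bessel's inequality. The rows of Q divided by s_i are orthonormal where s_i is nonzero, and are
    0 elsewhere since the inverse of 0 is 0; v - Y^* y is the part of v orthogonal to them. *)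
Lemma bessel_diag N (Q : 'M[C]_N) (s : 'I_N -> C) (v : 'cV[C]_N) :
  (forall i, 0 <= s i) -> Q *m Q ^t* = diag_mx (\row_i (s i ^+ 2)) ->
  sqr_norm (\col_i ((s i)^-1 * (Q *m v) i 0)) <= sqr_norm v.
Proof.
move=> s0 QQ; set y := \col__ _.
pose Y := diag_mx (\row_i (s i)^-1) *m Q.
have yE : Y *m v = y.
  by apply/colP => i; rewrite /Y -mulmxA mul_diag_mx !mxE.
have dE : (diag_mx (\row_i (s i)^-1)) ^t* = diag_mx (\row_i (s i)^-1) :> 'M[C]_N.
  apply/matrixP => i j; rewrite !mxE eq_sym; case: eqP => [->|_]; last by rewrite !mulr0n conjC0.
  by rewrite !mulr1n; apply: geC0_conj; rewrite invr_ge0.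
have YYy : Y *m (Y ^t* *m y) = y.
  rewrite mulmxA /Y adjmxM dE mulmxA -[_ *m Q *m _]mulmxA QQ -!mulmxA.
  apply/colP => i; rewrite !mul_diag_mx !mxE.
  have [->|si0] := eqVneq (s i) 0; first by rewrite !(invr0, mul0r).
  by move: (\sum_j _) => q; field.
clearbody Y y; suff E : sqr_norm (v - Y ^t* *m y) = sqr_norm v - sqr_norm y.
  by rewrite -subr_ge0 -E sqr_norm_ge0.
rewrite !sqr_normE adjmxB adjmxM adjmxK mulmxBl !mulmxBr -!mulmxA YYy.
have -> : y ^t* *m (Y *m v) = y ^t* *m y by rewrite yE.
have -> : v ^t* *m (Y ^t* *m y) = y ^t* *m y by rewrite mulmxA -adjmxM yE.
by rewrite subrr subr0 !mxE.
Qed.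

(* With [x], [b] the coordinates of the two defects, [b] rescaled by [1 / s],
   (s_i^2 - |y|^2) (P v)_i = y x_i + s_i b_i; divide by [s_i + |y|]. *)
Lemma singular_defect N (A P : 'M[C]_N) (s : 'I_N -> C) (v : 'cV[C]_N) (y : C) :
  P \is unitarymx -> (forall i, 0 <= s i) ->
  P *m (A ^t* *m A) = diag_mx (\row_i (s i ^+ 2)) *m P ->
  \sum_(i < N) `|s i - `|y| | ^+ 2 * `|(P *m v) i 0| ^+ 2 <=
    2 * (sqr_norm (A ^t* *m v - y^* *: v) + sqr_norm (A *m v - y *: v)).
Proof.
move=> uP s0 PA; set d' := _ - y^* *: v; set d := _ - y *: v.
pose Q := P *m A ^t*; pose x := P *m d'.
pose b := \col_i ((s i)^-1 * (Q *m d) i 0) : 'cV[C]_N.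
have QQ : Q *m Q ^t* = diag_mx (\row_i (s i ^+ 2)).
  rewrite adjmxM adjmxK mulmxA -[_ *m _ *m A]mulmxA PA -mulmxA.
  by move/unitarymxP : uP => ->; rewrite mulmx1.
apply: (@le_trans _ _ (2 * (sqr_norm x + sqr_norm b))); last first.
  by rewrite ler_pM2l // lerD ?sqr_norm_unitary // bessel_diag.
have key i : (s i ^+ 2 - `|y| ^+ 2) * (P *m v) i 0 = y * x i 0 + s i * b i 0.
  (* Where s_i = 0 the rescaling loses nothing: row i of Q has squared norm s_i^2 = 0, so both sides
     vanish. *)
  have sQ : s i * b i 0 = (Q *m d) i 0.
    rewrite mxE; have [si0|si0] := eqVneq (s i) 0; last by rewrite mulrA mulfV ?mul1r.
    have : (Q *m Q ^t*) i i = 0 by rewrite QQ mxE eqxx mxE si0 expr0n.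
    rewrite mxE => /eqP; rewrite psumr_eq0 => [/allP H|j _]; last first.
      by rewrite !mxE; exact: mul_conjC_ge0.
    rewrite si0 mul0r mxE big1 // => j _.
    have := H j; rewrite mem_index_enum => /(_ isT); rewrite !mxE mul_conjC_eq0.
    by move=> /eqP ->; rewrite mul0r.
  have -> : y * x i 0 = (P *m (y *: d')) i 0 by rewrite -scalemxAr [RHS]mxE.
  rewrite sQ /Q -mulmxA.
  have -> : (P *m (y *: d')) i 0 + (P *m (A ^t* *m d)) i 0 = (P *m (y *: d' + A ^t* *m d)) i 0.
    by move: (y *: d') (A ^t* *m d) => u1 u2; rewrite mulmxDr [RHS]mxE.
  have -> : y *: d' + A ^t* *m d = A ^t* *m A *m v - `|y| ^+ 2 *: v.
    rewrite /d' /d mulmxBr scalerBr -scalemxAr mulmxA scalerA -normCK.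
    by rewrite addrAC addrCA subrr addr0.
  rewrite mulmxBr mulmxA PA -mulmxA mul_diag_mx -scalemxAr !mxE.
  by rewrite mulrBl.
rewrite /sqr_norm -big_split mulr_sumr; apply: ler_sum => i _ /=.
set w := (P *m v) i 0; set xi := `|x i 0|; set bi := `|b i 0|.
have xi0 : 0 <= xi := normr_ge0 _; have bi0 : 0 <= bi := normr_ge0 _.
have y0 := normr_ge0 y; have si := s0 i.
have dreal : s i - `|y| \is Num.real by rewrite rpredB // ger0_real.
have main : `|s i - `|y| | * `|w| <= xi + bi.
  have [sy0|sy0] := eqVneq (s i + `|y|) 0.
    move/eqP: sy0; rewrite paddr_eq0 // => /andP[/eqP -> /eqP ->].
    by rewrite subrr normr0 mul0r addr_ge0.
  have sy : 0 < s i + `|y| by rewrite lt_def sy0 addr_ge0.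
  rewrite -(ler_pM2r sy) mulrAC -[X in _ * X * _](ger0_norm (ltW sy)) -normrM -subr_sqr.
  rewrite -normrM key (le_trans (ler_normD _ _)) // !normrM (ger0_norm si) mulrDl.
  rewrite [xi * _]mulrC [bi * _]mulrC -/xi -/bi.
  by rewrite lerD // ler_wpM2r // ?lerDl ?lerDr.
rewrite -exprMn (le_trans (_ : _ <= (xi + bi) ^+ 2)) //.
  by rewrite lerXn2r ?nnegrE ?mulr_ge0 // addr_ge0.
rewrite -subr_ge0; have -> : 2 * (xi ^+ 2 + bi ^+ 2) - (xi + bi) ^+ 2 = (xi - bi) ^+ 2 by ring.
by rewrite real_exprn_even_ge0 // rpredB // ger0_real.
Qed.

Lemma gram_spectral N (A : 'M[C]_N) :
  exists (P : 'M[C]_N) (s : 'I_N -> C), [/\ P \is unitarymx, forall i, 0 <= s i,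
    P *m (A ^t* *m A) = diag_mx (\row_i (s i ^+ 2)) *m P &
    char_poly (A ^t* *m A) = \prod_(i < N) ('X - (s i ^+ 2)%:P)].
Proof.
have [|P [d [uP PA _ chi]]] := @hermitian_spectral N (A ^t* *m A).
  by rewrite adjmxM adjmxK.
have d0 i : 0 <= d i.
  have : (P *m (A ^t* *m A) *m P ^t*) i i = d i.
    by rewrite PA -mulmxA; move/unitarymxP : uP => ->; rewrite mulmx1 !mxE eqxx mulr1n.
  have -> : P *m (A ^t* *m A) *m P ^t* = (A *m P ^t*) ^t* *m (A *m P ^t*).
    by rewrite adjmxM adjmxK !mulmxA.
  move=> <-; rewrite mxE; apply: sumr_ge0 => j _; rewrite !mxE mulrC.
  exact: mul_conjC_ge0.
have dE i : sqrtC (d i) ^+ 2 = d i by rewrite sqrtCK.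
exists P, (fun i => sqrtC (d i)); split => //; first by move=> i; rewrite sqrtC_ge0.
  by rewrite PA; congr (diag_mx _ *m _); apply/rowP => i; rewrite !mxE dE.
by rewrite chi; apply: eq_bigr => i _; rewrite dE.
Qed.

End SpectralDefect.

(** * Averaging over the trial vectors *)

Section SzegoAveraging.
Context {R : realType}.
Local Notation C := R[i].
Implicit Types (f g h : C -> C) (t : R).

Lemma sum_divmod (V : nmodType) (n m : nat) (F : nat -> nat -> V) : (0 < m)%N ->
  \sum_(j < n * m) F (j %/ m)%N (j %% m)%N = \sum_(k < n) \sum_(r < m) F k r.
Proof.
move=> m0; elim: n => [|n IH]; first by rewrite [RHS]big_ord0; exact: big_ord0.
rewrite [RHS]big_ord_recr /= -IH mulSnr big_split_ord /=; congr (_ + _).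
apply: eq_bigr => r _; rewrite divnMDl // modnMDl modn_small //.
by rewrite divn_small // addn0.
Qed.

Variables (n m : nat) (P : 'M[C]_(n * m)).
Hypotheses (n0 : (0 < n)%N) (m0 : (0 < m)%N) (uP : P \is unitarymx).

(* [n^(-1/2) * trial_vector r z] is an approximate eigenvector of the block
   Toeplitz matrix of [f], for the approximate eigenvalue [f z]. *)
Definition trial_vector (r : 'I_m) (z : C) : 'cV[C]_(n * m) :=
  \col_j (if (j %% m)%N == r then z ^ (- Posz (j %/ m)) else 0).

Let w (i : 'I_(n * m)) r z : C := `|(P *m trial_vector r z) i 0| ^+ 2.

Lemma trial_weight_ge0 i r z : 0 <= w i r z.
Proof. by rewrite exprn_ge0. Qed.

Lemma trial_weight_sum r t : \sum_i w i r (circle_pt t) = n%:R.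
Proof.
rewrite -/(sqr_norm (P *m _)) sqr_norm_unitary //.
pose F (k l : nat) : C := (l == r :> nat)%:R.
transitivity (\sum_(j < n * m) F (j %/ m)%N (j %% m)%N).
  apply: eq_bigr => j _; rewrite mxE /F; case: eqP => _; last by rewrite normr0 expr0n.
  by rewrite norm_circle_ptz expr1n.
rewrite sum_divmod //; transitivity (\sum_(k < n) (1 : C)).
  apply: eq_bigr => k _; rewrite (bigD1 r) //= /F eqxx big1 ?addr0 // => l lr.
  by rewrite -val_eqE /= in lr; rewrite (negPf lr).
by rewrite sumr_const card_ord.
Qed.

Lemma trial_entry_bounded i r : circle_bounded (fun z => (P *m trial_vector r z) i 0).
Proof.
apply: (@eq_circle_bounded _ (fun z => \sum_(j < n * m)
   (P i j * (((j %% m)%N == r)%:R * z ^ (- Posz (j %/ m)))))).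
  move=> t; rewrite mxE; apply: eq_bigr => j _; rewrite mxE.
  by case: eqP; rewrite ?mul1r ?mul0r.
elim: (index_enum _) => [|j s IH].
  by apply: eq_circle_bounded (circle_bounded_cst 0) => t; rewrite big_nil.
apply: (@eq_circle_bounded _ (fun z => P i j * (((j %% m)%N == r)%:R * z ^ (- Posz (j %/ m))) +
   \sum_(j <- s) (P i j * (((j %% m)%N == r)%:R * z ^ (- Posz (j %/ m)))))).
  by move=> t; rewrite big_cons.
apply: circle_boundedD IH; do 2 apply: circle_boundedM (circle_bounded_cst _) _.
exact: circle_bounded_exprz_id.
Qed.

Lemma trial_weight_bounded i r : circle_bounded (w i r).
Proof.
have b := trial_entry_bounded i r.
apply: eq_circle_bounded (circle_boundedM b (circle_bounded_conj b)) => t.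
by rewrite /w normCK.
Qed.

(** Parseval: entry i of P times the trial vector is a trigonometric polynomial whose coefficients
    are the entries of row i of P in the columns of residue r. Summing over r gives the squared norm
    of a row of a unitary matrix. *)
Lemma trial_weight_mean i : \sum_r circle_mean (w i r) = 1.
Proof.
pose u (r : 'I_m) (j : 'I_(n * m)) (z : C) : C :=
  (P i j * ((j %% m)%N == r)%:R) * z ^ (- Posz (j %/ m)).
have Lu r j : L2 (u r j) by exact/L2Z/L2_exprz.
have E r : circle_mean (w i r) = \sum_(j < n * m) P i j * ((j %% m)%N == r)%:R * (P i j)^*.
  transitivity (inner (fun z => \sum_(j < n * m) u r j z) (fun z => \sum_(j < n * m) u r j z)).
    apply: eq_circle_mean => t; rewrite /w normCK.
    suff -> : (P *m trial_vector r (circle_pt t)) i 0 = \sum_(j < n * m) u r j (circle_pt t) by [].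
    rewrite mxE; apply: eq_bigr => j _; rewrite mxE /u -mulrA.
    by case: eqP; rewrite ?mul1r ?mul0r.
  rewrite inner_suml //; last exact: L2_sum.
  have Iu j k : inner (u r j) (u r k) = P i j * ((j %% m)%N == r)%:R *
      (P i k * ((k %% m)%N == r)%:R)^* * (- Posz (j %/ m) == - Posz (k %/ m))%:R.
    rewrite /u innerZl; [|exact: L2_exprz|exact: (Lu r k)].
    by rewrite innerZr; [rewrite inner_exprz mulrA|exact: L2_exprz..].
  apply: eq_bigr => j _; rewrite inner_sumr // (bigD1 j) //= [X in _ + X]big1 ?addr0.
    rewrite Iu eqxx mulr1 rmorphM /= conjC_nat.
    by case: eqP => _; rewrite ?mulr1 ?mulr0 ?mul0r.
  move=> k kj; rewrite Iu rmorphM /= conjC_nat eqr_opp.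
  have [jr|_] := eqVneq (j %% m)%N (val r); last by rewrite mulr0 !mul0r.
  have [kr|_] := eqVneq (k %% m)%N (val r); last by rewrite !mulr0 mul0r.
  have [jk|_] := eqVneq (Posz (j %/ m)) (Posz (k %/ m)); last by rewrite mulr0.
  by case/eqP: kj; apply: val_inj => /=; rewrite (divn_eq k m) (divn_eq j m) jr kr; case: jk => ->.
under eq_bigr do rewrite E.
rewrite exchange_big /=; transitivity (\sum_j P i j * (P i j)^*).
  apply: eq_bigr => j _; rewrite (bigD1 (Ordinal (ltn_pmod j m0))) //= eqxx mulr1.
  rewrite big1 ?addr0 // => r; rewrite -val_eqE /= eq_sym => /negPf ->.
  by rewrite mulr0 mul0r.
have /unitarymxP/matrixP/(_ i i) := uP; rewrite [RHS]mxE eqxx mxE => H.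
by rewrite -[RHS]H; apply: eq_bigr => j _; rewrite !mxE.
Qed.

(* Both terms of the difference are averages against the weights [w], whose
   sums over [i] and whose means are constant. *)
Lemma averaging_bound (d : 'I_(n * m) -> C) f g (eps K : C) (B : 'I_m -> C -> C) :
  0 <= K -> L2 f ->
  circle_bounded (fun z => g (f z)) ->
  (forall x y, `|g x - g y| <= eps + K * `|x - y| ^+ 2) ->
  (forall r, circle_integrable (B r)) ->
  (forall r t, \sum_i `|d i - f (circle_pt t)| ^+ 2 * w i r (circle_pt t) <=
     B r (circle_pt t)) ->
  `|(n * m)%:R^-1 * \sum_i g (d i) - circle_mean (fun z => g (f z))| <=
    eps + K * (n * m)%:R^-1 * \sum_r circle_mean (B r).
Proof.
move=> K0 Lf gf gK iB dB.
have nmn0 : (n * m)%:R != 0 :> C by rewrite pnatr_eq0 -lt0n muln_gt0 n0.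
have iw i r : circle_integrable (w i r) := circle_bounded_integrable (trial_weight_bounded i r).
have iwg i r : circle_integrable (fun z => w i r z * g (f z)).
  exact/circle_bounded_integrable/circle_boundedM/gf/trial_weight_bounded.
pose F r z := \sum_i w i r z * (g (d i) - g (f z)).
have iF r : circle_integrable (F r) /\
    circle_mean (F r) = \sum_i (g (d i) * circle_mean (w i r)) -
      n%:R * circle_mean (fun z => g (f z)).
  have iFi i : circle_integrable (fun z => w i r z * (g (d i) - g (f z))).
    apply: circle_bounded_integrable; apply: circle_boundedM.
      exact: trial_weight_bounded.
    exact: circle_boundedB (circle_bounded_cst _) gf.
  have [h1 h2] := @circle_mean_sum _ _ (index_enum _) predT _ (fun i _ _ => iFi i).
  split => //; rewrite h2.
  under eq_bigr => i _.
    rewrite (_ : circle_mean _ = g (d i) * circle_mean (w i r) -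
      circle_mean (fun z => w i r z * g (f z))); last first.
      rewrite -circle_meanZ // -circle_meanB //; last exact: circle_integrableZ.
      by apply: eq_circle_mean => t; rewrite mulrBr [w i r _ * g (d i)]mulrC.
    over.
  rewrite sumrB; congr (_ - _).
  rewrite -(proj2 (@circle_mean_sum _ _ (index_enum _) predT _ (fun i _ _ => iwg i r))).
  rewrite -circle_meanZ; last exact: circle_bounded_integrable.
  by apply: eq_circle_mean => t; rewrite -mulr_suml trial_weight_sum.
have -> : (n * m)%:R^-1 * \sum_i g (d i) - circle_mean (fun z => g (f z)) =
    (n * m)%:R^-1 * \sum_r circle_mean (F r).
  under [in RHS]eq_bigr do rewrite (proj2 (iF _)).
  rewrite sumrB sumr_const card_ord exchange_big /= mulrBr; congr (_ - _).
    by congr (_ * _); apply: eq_bigr => i _; rewrite -mulr_sumr trial_weight_mean mulr1.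
  by rewrite -[n%:R * _ *+ m]mulr_natl [m%:R * _]mulrA -natrM [(m * n)%N]mulnC mulKf.
rewrite normrM ger0_norm ?invr_ge0 //.
have FB r : `|circle_mean (F r)| <= n%:R * eps + K * circle_mean (B r).
  rewrite -[n%:R * eps](@circle_mean_cst R) -circle_meanZ // -circle_meanD;
    [|exact: circle_integrable_cst|exact: circle_integrableZ].
  apply: norm_circle_mean_le.
  - exact: (proj1 (iF r)).
  - by apply: circle_integrableD; [exact: circle_integrable_cst|exact: circle_integrableZ].
  move=> t; apply: le_trans (ler_norm_sum _ _ _) _.
  apply: (@le_trans _ _ (\sum_i w i r (circle_pt t) * (eps + K * `|d i - f (circle_pt t)| ^+ 2))).
    apply: ler_sum => i _; rewrite normrM ger0_norm ?trial_weight_ge0 //.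
    by rewrite ler_wpM2l ?trial_weight_ge0.
  under eq_bigr do rewrite mulrDr mulrCA.
  rewrite big_split /= -mulr_suml trial_weight_sum lerD2l -mulr_sumr ler_wpM2l //.
  apply: le_trans (dB r t); rewrite le_eqVlt; apply/orP; left; apply/eqP.
  by apply: eq_bigr => i _; rewrite mulrC.
rewrite ler_pdivrMl ?ltr0n ?muln_gt0 ?n0 //.
apply: le_trans (ler_norm_sum _ _ _) _.
apply: le_trans (ler_sum _ (fun r _ => FB r)) _.
rewrite big_split /= sumr_const card_ord -[_ *+ m]mulr_natl [m%:R * _]mulrA.
rewrite -natrM [(m * n)%N]mulnC mulrDr lerD2l -mulr_sumr [K / _]mulrC.
by rewrite -[_^-1 * K * _]mulrA mulVKf.
Qed.

End SzegoAveraging.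

(** * Toeplitz matrices and windows of a Fourier series *)

Section ToeplitzDefect.
Local Open Scope sesquilinear_scope.
Context {R : realType}.
Local Notation C := R[i].
Implicit Types (f g h : C -> C) (t : R) (a : int -> C).

Definition laurent_sum a (s : seq int) : C -> C := fun z => \sum_(k <- s) a k * exprz z k.

(** The exponents whose coefficients occur in block row k; the matrix replaces the symbol by its
    partial sum over this window. *)
Definition toeplitz_window (n k : nat) : seq int :=
  [seq (Posz k - Posz (val l))%R | l : 'I_n].

Definition symmetric_window (N : nat) : seq int :=
  [seq (Posz k - Posz N)%R | k <- iota 0 N.*2.+1].

Definition block_toeplitz a n m : 'M[C]_(n * m) :=
  \matrix_(i, j) if (i %% m)%N == (j %% m)%N then a (Posz (i %/ m) - Posz (j %/ m)) else 0.

Lemma uniq_toeplitz_window n k : uniq (toeplitz_window n k).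
Proof.
rewrite map_inj_uniq ?enum_uniq // => l l' H; apply: val_inj => /=.
by move: H => /= H; lia.
Qed.

Lemma uniq_symmetric_window N : uniq (symmetric_window N).
Proof. by rewrite map_inj_uniq ?iota_uniq // => l l' H; lia. Qed.

Lemma mem_symmetric_window N (k : int) : (absz k <= N)%N -> k \in symmetric_window N.
Proof.
move=> kN; apply/mapP; exists (absz (k + Posz N)); last by lia.
by rewrite mem_iota; lia.
Qed.

(** A row at distance at least N from both ends sees all the exponents from -N to N. *)
Lemma sub_toeplitz_window n k N : (N <= k)%N -> (k + N < n)%N ->
  {subset symmetric_window N <= toeplitz_window n k}.
Proof.
move=> Nk kN _ /mapP[j + ->]; rewrite mem_iota add0n => /= jN.
have lt : (k + N - j < n)%N by lia.
by apply/mapP; exists (Ordinal lt); rewrite ?mem_enum //=; lia.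
Qed.

Lemma toeplitz_window_sum n k a z :
  laurent_sum a (toeplitz_window n k) z =
  \sum_(l < n) a (Posz k - Posz l) * exprz z (Posz k - Posz l).
Proof. by rewrite /laurent_sum big_map big_enum. Qed.

Lemma L2_laurent_sum a s : L2 (laurent_sum a s).
Proof. by apply: (L2_sum _ _ (F := fun k z => _)) => k; exact/L2Z/L2_exprz. Qed.

Lemma inner_laurent_exprz a s k : uniq s ->
  inner (laurent_sum a s) (fun z => exprz z k) = if k \in s then a k else 0.
Proof.
move=> us; rewrite inner_suml => [|j|]; [|exact/L2Z/L2_exprz|exact: L2_exprz].
transitivity (\sum_(j <- s) if j == k then a j else 0).
  apply: eq_bigr => j _; rewrite innerZl; [|exact: L2_exprz..].
  by rewrite inner_exprz; case: eqP => _; rewrite ?mulr1 ?mulr0.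
case: ifP => ks; last by rewrite big1_seq // => j /= js; case: eqP => // jk; rewrite -jk js in ks.
rewrite (bigD1_seq k) //= eqxx big1 ?addr0 // => j /negPf jk.
by rewrite jk.
Qed.

Lemma sum_lt_le n N : (\sum_(k < n) (k < N) <= N)%N.
Proof.
suff : (\sum_(k < n) (k < N) <= minn n N)%N by lia.
elim: n => [|n IH]; first by rewrite big_ord0.
rewrite big_ord_recr /=; move: IH; move: (\sum_(_ < _) _)%N => S.
by case: (ltnP n N) => /=; lia.
Qed.

Lemma L2_series_small (u : int -> C -> C) f (e : R) : L2_series u f -> 0 < e ->
  exists N0, forall N, (N0 <= N)%N ->
  inner (fun z => f z - \sum_(k <- symmetric_window N) u k z)
        (fun z => f z - \sum_(k <- symmetric_window N) u k z) <= (e%:C)%C.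
Proof.
move=> fu e0; have se0 : 0 < Num.sqrt e by rewrite sqrtr_gt0.
have /cvgrPdist_lt/(_ _ se0) [N0 _ H] := fu; exists N0 => N /H.
rewrite /= sub0r normrN.
have -> : L2norm (fun z => f z - \sum_(0 <= k < N.*2.+1) u (Posz k - Posz N) z) =
    L2norm (fun z => f z - \sum_(k <- symmetric_window N) u k z).
  congr (L2norm _); apply/funext => z; congr (_ - _).
  by rewrite big_map /index_iota subn0.
set x := inner _ _; have x0 : 0 <= x := inner_ge0 _.
have xE : x = (complex.Re x)%:C%C.
  by apply: complex_eqP => //=; move: x0; rewrite complex_leE => /andP[/eqP].
have r0 : 0 <= complex.Re x by move: x0; rewrite complex_leE => /andP[].
rewrite /L2norm -/x ger0_norm ?sqrtr_ge0 // ltr_sqrt // => /ltW.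
by rewrite xE lecR.
Qed.

(** By Cauchy-Schwarz the inner products of the partial sums with h converge to that of f.
    Orthogonality makes them eventually constant in the applications, so the limit is read off at
    once. *)
Lemma L2_series_inner (u : int -> C -> C) f h c (N1 : nat) :
  L2_series u f -> L2 f -> (forall k, L2 (u k)) -> L2 h ->
  (forall N, (N1 <= N)%N -> \sum_(k <- symmetric_window N) inner (u k) h = c) ->
  inner f h = c.
Proof.
move=> fu Lf Lu Lh cN; apply/eqP; rewrite -subr_eq0 -normr_eq0 eq_le normr_ge0 andbT.
set x := `|_|; have x0 : 0 <= x := normr_ge0 _.
pose M := complex.Re (inner h h).
have hh0 := inner_ge0 h.
have ME : inner h h = M%:C%C.
  by apply: complex_eqP => //=; move: hh0; rewrite complex_leE => /andP[/eqP].
have M0 : 0 <= M by rewrite -ler0c -ME.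
suff H (e : R) : 0 < e -> complex.Re x <= e.
  rewrite /x -Re_norm -[0]/((0 : R)%:C%C) lecR; apply/ler_addgt0Pl => e e0.
  by rewrite addr0 H.
move=> e0; have M1 : 0 < M + 1 by rewrite ltr_wpDl.
(* The squared distance e^2 / (M + 1), multiplied by M = [inner h h], stays below e^2; adding 1
   keeps the divisor positive when M = 0. *)
have [N0 HN] := L2_series_small fu (divr_gt0 (exprn_gt0 2 e0) M1).
pose N := maxn N0 N1; have := HN N (leq_maxl _ _).
set d := fun z => _ => dd.
have LS : L2 (fun z => \sum_(k <- symmetric_window N) u k z) by exact: L2_sum.
have Ld : L2 d by exact: L2B.
have := inner_CauchySchwarz Ld Lh.
rewrite innerBl // inner_suml // cN ?leq_maxr // -/x.
move/le_trans => /(_ _ (ler_wpM2r hh0 dd)).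
rewrite /x -Re_norm ME -rmorphXn -(rmorphM (real_complex R)) lecR /= => H.
rewrite -ler_sqr ?nnegrE ?(ltW e0) //; last by rewrite -ler0c Re_norm.
rewrite (le_trans H) // mulrAC ler_pdivrMr // ler_wpM2l ?exprn_ge0 ?(ltW e0) //.
by rewrite lerDl.
Qed.

Section Symbol.
Variables (a : int -> C) (f : C -> C).
Hypotheses (Lf : L2 f) (fa : L2_series (fun n z => a n * z ^ n) f).

Lemma series_fourier k : inner f (fun z => exprz z k) = a k.
Proof.
apply: (L2_series_inner (N1 := absz k) fa) => // [j||N kN].
- exact/L2Z/L2_exprz.
- exact: L2_exprz.
transitivity (inner (laurent_sum a (symmetric_window N)) (fun z => exprz z k)).
  by rewrite inner_suml // => [j|]; [exact/L2Z/L2_exprz|exact: L2_exprz].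
by rewrite inner_laurent_exprz ?uniq_symmetric_window // mem_symmetric_window.
Qed.

Lemma laurent_defect s : uniq s ->
  inner (fun z => f z - laurent_sum a s z) (fun z => f z - laurent_sum a s z) =
  inner f f - \sum_(k <- s) `|a k| ^+ 2.
Proof.
move=> us; have LW := L2_laurent_sum a s; have LB := L2B Lf LW.
have fW : inner f (laurent_sum a s) = \sum_(k <- s) `|a k| ^+ 2.
  rewrite inner_sumr => [|k|//]; last exact/L2Z/L2_exprz.
  apply: eq_bigr => k _; rewrite innerZr //; last exact: L2_exprz.
  by rewrite series_fourier normCK mulrC.
have WW : inner (laurent_sum a s) (laurent_sum a s) = \sum_(k <- s) `|a k| ^+ 2.
  rewrite [X in inner _ X]/laurent_sum inner_sumr => [|k|//]; last exact/L2Z/L2_exprz.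
  rewrite !big_seq; apply: eq_bigr => k ks; rewrite innerZr //; last exact: L2_exprz.
  by rewrite inner_laurent_exprz // ks normCK mulrC.
have SS : (\sum_(k <- s) `|a k| ^+ 2)^* = \sum_(k <- s) `|a k| ^+ 2.
  by rewrite rmorph_sum; apply: eq_bigr => k _ /=; rewrite geC0_conj ?exprn_ge0.
by rewrite innerBl // !innerBr // (innerC Lf LW) fW WW SS subrr subr0.
Qed.

Lemma laurent_defect_le s s' : uniq s -> uniq s' -> {subset s' <= s} ->
  inner (fun z => f z - laurent_sum a s z) (fun z => f z - laurent_sum a s z) <=
  inner (fun z => f z - laurent_sum a s' z) (fun z => f z - laurent_sum a s' z).
Proof.
move=> us us' ss'; rewrite !laurent_defect // lerD2l lerN2.
rewrite [leRHS](bigID (mem s')) /=.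
have -> : \sum_(k <- s') `|a k| ^+ 2 = \sum_(k <- s | k \in s') `|a k| ^+ 2.
  rewrite -[RHS]big_filter; apply: perm_big; apply: uniq_perm => //.
    exact: filter_uniq.
  by move=> k; rewrite mem_filter; case: (boolP (k \in s')) => //= /ss'.
by rewrite lerDl; apply: sumr_ge0 => k _; rewrite exprn_ge0.
Qed.

(** A window containing the exponents from -N to N is at least as good as the symmetric partial sum,
    so all but at most 2 N rows have defect at most e/2. The remaining rows, near the two ends, have
    defect at most [inner f f]. *)
Lemma toeplitz_defect_small (e : C) : 0 < e -> exists n0, forall n, (n0 <= n)%N -> (0 < n)%N ->
  n%:R^-1 * \sum_(k < n) inner
    (fun z => f z - laurent_sum a (toeplitz_window n k) z)
    (fun z => f z - laurent_sum a (toeplitz_window n k) z) <= e.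
Proof.
move=> e0; have [e1 eE] : exists e1 : R, e = (e1%:C)%C.
  by apply/complex_realP; exact: gtr0_real.
have e10 : 0 < e1 by rewrite -ltcR -eE.
have [N HN] := L2_series_small fa (divr_gt0 e10 (ltr0Sn R 1)).
have {}HN := HN N (leqnn _).
pose M := complex.Re (inner f f).
have ff0 := inner_ge0 f.
have ME : inner f f = M%:C%C.
  by apply: complex_eqP => //=; move: ff0; rewrite complex_leE => /andP[/eqP].
have M0 : 0 <= M by rewrite -ler0c -ME.
(* From this size on, the total 2 N M of the end rows is at most n e/2. *)
exists (Num.truncn ((2 * N)%:R * M / (e1 / 2))).+1 => n n0 ngt0.
rewrite ler_pdivrMl ?ltr0n //.
pose big (k : 'I_n) : C := inner (fun z => f z - laurent_sum a (toeplitz_window n k) z)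
    (fun z => f z - laurent_sum a (toeplitz_window n k) z).
have b1 (k : 'I_n) : big k <= inner f f.
  rewrite /big laurent_defect ?uniq_toeplitz_window // gerBl.
  by apply: sumr_ge0 => j _; rewrite exprn_ge0.
have b2 (k : 'I_n) : (N <= k)%N -> (k + N < n)%N -> big k <= ((e1 / 2)%:C)%C.
  move=> h1 h2; apply: le_trans HN; apply: laurent_defect_le.
  - exact: uniq_toeplitz_window.
  - exact: uniq_symmetric_window.
  - exact: sub_toeplitz_window.
have b3 (k : 'I_n) : big k <= ((e1 / 2)%:C)%C +
    ((k < N)%N%:R + (n - N <= k)%N%:R) * inner f f.
  have e2 : 0 <= ((e1 / 2)%:C)%C :> C by rewrite ler0c divr_ge0 ?ltW.
  have [kN|kN] := ltnP k N.
    rewrite (le_trans (b1 k)) // mulrDl mul1r addrCA lerDl addr_ge0 // mulr_ge0 //.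
  have [nk|nk] := leqP (n - N) k.
    by rewrite add0r mul1r (le_trans (b1 k)) // lerDr.
  by rewrite addr0 mul0r addr0 b2 //; lia.
apply: le_trans (ler_sum _ (fun k _ => b3 k)) _.
rewrite big_split /= sumr_const card_ord -mulr_suml big_split /=.
have c1 : \sum_(k < n) (k < N)%N%:R <= N%:R :> C.
  by rewrite -natr_sum ler_nat sum_lt_le.
have c2 : \sum_(k < n) (n - N <= k)%N%:R <= N%:R :> C.
  rewrite -natr_sum ler_nat (leq_trans _ (sum_lt_le n N)) //.
  rewrite (reindex_inj rev_ord_inj); apply: leq_sum => k _ /=.
  by have := ltn_ord k; case: leqP => //=; case: ltnP => //=; lia.
apply: (@le_trans _ _ (((e1 / 2)%:C)%C *+ n + (2 * N)%:R * inner f f)).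
  by rewrite lerD2l ler_wpM2r // mul2n -addnn natrD lerD.
have natC (k : nat) : k%:R = (k%:R : R)%:C%C :> C by rewrite rmorph_nat.
rewrite ME eE -[_ *+ n]mulr_natl (natC n) (natC (2 * N)%N).
rewrite -!(rmorphM (real_complex R)) -(rmorphD (real_complex R)) lecR.
have e20 : 0 < e1 / 2 by rewrite divr_gt0.
have : (2 * N)%:R * M / (e1 / 2) <= n%:R.
  by rewrite (le_trans (ltW (truncnS_gt _))) // ler_nat.
rewrite ler_pdivrMr // => H; rewrite (le_trans (lerD (lexx _) H)) //.
by rewrite -mulrDr -splitr.
Qed.

End Symbol.

Lemma block_toeplitz_adj a n m :
  (block_toeplitz a n m) ^t* = block_toeplitz (fun k => (a (- k))^*) n m.
Proof.
apply/matrixP => i j; rewrite !mxE eq_sym; case: eqP => _; last by rewrite conjC0.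
by rewrite opprB.
Qed.

(** Only the rows of residue r contribute. In block row k, factoring out z^(-k) leaves the window
    sum minus y, and the factor has modulus 1. *)
Lemma block_toeplitz_defect a n m (r : 'I_m) (y : C) t : (0 < m)%N ->
  sqr_norm (block_toeplitz a n m *m trial_vector n r (circle_pt t) -
            y *: trial_vector n r (circle_pt t)) =
  \sum_(k < n) `|y - laurent_sum a (toeplitz_window n k) (circle_pt t)| ^+ 2.
Proof.
move=> m0; set z := circle_pt t; have z0 : z != 0 := circle_pt_neq0 t.
pose F k l : C := if l == r :> nat then `|y - laurent_sum a (toeplitz_window n k) z| ^+ 2 else 0.
transitivity (\sum_(j < n * m) F (j %/ m)%N (j %% m)%N); last first.
  rewrite sum_divmod //; apply: eq_bigr => k _.
  rewrite (bigD1 r) //= /F eqxx big1 ?addr0 // => l.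
  by rewrite -val_eqE /= => /negPf ->.
apply: eq_bigr => i _; rewrite /F !mxE.
have Az : \sum_j block_toeplitz a n m i j * trial_vector n r z j 0 =
    if (i %% m)%N == r then \sum_(l < n) a (Posz (i %/ m) - Posz l) * exprz z (- Posz l) else 0.
  pose G (k l : nat) : C := if ((i %% m)%N == l) && (l == r) then
    a (Posz (i %/ m) - Posz k) * exprz z (- Posz k) else 0.
  transitivity (\sum_(j < n * m) G (j %/ m)%N (j %% m)%N).
    apply: eq_bigr => j _; rewrite !mxE /G.
    by case: eqP => // _; case: eqP => // _; rewrite ?mulr0 ?mul0r.
  rewrite sum_divmod //; case: ifP => [/eqP ir|ir].
    apply: eq_bigr => k _; rewrite (bigD1 r) //= /G ir !eqxx big1 ?addr0 // => l.
    by rewrite -val_eqE /= eq_sym => /negPf ->.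
  rewrite big1 // => k _; rewrite big1 // => l _; rewrite /G.
  by case: eqP => //= <-; rewrite ir.
rewrite Az; case: ifP => _; last by rewrite mulr0 subr0 normr0 expr0n.
set k := (i %/ m)%N.
have -> : \sum_(l < n) a (Posz k - Posz l) * exprz z (- Posz l) - y * exprz z (- Posz k) =
    - (exprz z (- Posz k) * (y - laurent_sum a (toeplitz_window n k) z)).
  rewrite toeplitz_window_sum mulrBr opprB mulr_sumr [y * _]mulrC; congr (_ - _).
  apply: eq_bigr => l _; rewrite mulrCA -expfzDr //; congr (_ * exprz _ _).
  by rewrite addrA addNr sub0r.
by rewrite normrN normrM norm_circle_ptz mul1r.
Qed.

(** Reversing the order of rows and columns exchanges a Toeplitz matrix with its transpose. The
    defect of A^* at y^* is thus equal to that of A at y. *)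
Lemma toeplitz_window_rev a n t (y : C) :
  \sum_(k < n) `|y^* - laurent_sum (fun k => (a (- k))^*) (toeplitz_window n k) (circle_pt t)| ^+ 2 =
  \sum_(k < n) `|y - laurent_sum a (toeplitz_window n k) (circle_pt t)| ^+ 2.
Proof.
rewrite [RHS](reindex_inj rev_ord_inj); apply: eq_bigr => k _ /=.
rewrite -[in LHS]norm_conjC rmorphB /= conjCK !toeplitz_window_sum rmorph_sum.
rewrite [in RHS](reindex_inj rev_ord_inj); congr (`|_ - _| ^+ 2).
apply: eq_bigr => l _ /=; rewrite rmorphM /= conjCK conj_circle_ptz.
have -> : Posz (n - k.+1) - Posz (n - l.+1) = - (Posz k - Posz l).
  by have := ltn_ord k; have := ltn_ord l; lia.
by [].
Qed.

End ToeplitzDefect.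

(** * The matrix of the compressed Toeplitz operator *)

Section BlaschkeToeplitz.
Local Open Scope sesquilinear_scope.
Context {R : realType}.
Local Notation C := R[i].
Implicit Types (f g h : C -> C) (t : R).
Variables (m : nat) (hm : (0 < m)%N) (lam : 'I_m -> C).
Hypothesis hlam : forall i, `|lam i| < 1.

Definition periodic_zeros (l : nat) : C := lam (Ordinal (ltn_pmod l hm)).
Local Notation p := periodic_zeros.
Local Notation e := (takenaka_malmquist p).
Local Notation B := (blaschke lam).

Let p_lt1 l : `|p l| < 1. Proof. exact: hlam. Qed.

Lemma periodic_zerosMD k r : p (k * m + r) = p r.
Proof. by congr lam; apply: val_inj; rewrite /= modnMDl. Qed.

Lemma blaschke_rangeMD k r z :
  blaschke_range p (k * m) (k * m + r) z = blaschke_range p 0 r z.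
Proof.
rewrite /blaschke_range -[in LHS](add0n (k * m)%N) big_addn addnC addnK.
by apply: eq_bigr => l _; rewrite addnC periodic_zerosMD.
Qed.

Lemma blaschke_power n z : B z ^+ n = blaschke_range p 0 (n * m) z.
Proof.
elim: n => [|n IH]; first by rewrite /blaschke_range mul0n big_geq.
rewrite exprSr IH [in RHS]/blaschke_range mulSnr (big_cat_nat (n := (n * m)%N)) ?leq_addr //=.
congr (_ * _); rewrite -[RHS]/(blaschke_range p (n * m) (n * m + m) z) blaschke_rangeMD.
rewrite /blaschke_range big_mkord; apply: eq_bigr => i _.
rewrite /blaschke_factor /p; suff -> : Ordinal (ltn_pmod i hm) = i by [].
by apply: val_inj; rewrite /= modn_small.
Qed.

Lemma takenaka_malmquistMD k r z : e (k * m + r) z = B z ^+ k * e r z.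
Proof.
rewrite /takenaka_malmquist periodic_zerosMD blaschke_power -(blaschke_rangeMD k r).
rewrite [in LHS]/blaschke_range (big_cat_nat (n := (k * m)%N)) ?leq_addr //=.
by rewrite -/(blaschke_range _ _ _ _) -/(blaschke_range _ _ _ _); ring.
Qed.

Lemma norm_blaschke t : `|B (circle_pt t)| = 1.
Proof.
have := blaschke_power 1 (circle_pt t); rewrite expr1 => ->.
exact: norm_blaschke_range.
Qed.

Lemma circle_bounded_blaschkez n : circle_bounded (fun z => exprz (B z) n).
Proof.
apply: circle_bounded_exprz; last exact: norm_blaschke.
apply: eq_circle_bounded (circle_bounded_range p_lt1 0 (1 * m)) => t.
by rewrite -blaschke_power expr1.
Qed.

Let be' i : circle_bounded (e i).
Proof. exact: circle_bounded_takenaka_malmquist. Qed.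

Lemma conj_blaschkez t (n : int) :
  (exprz (B (circle_pt t)) n)^* = exprz (B (circle_pt t)) (- n).
Proof.
rewrite -exprz_inv -(unimodular_conj (norm_blaschke t)); exact: fmorphXz.
Qed.

(** For k >= 0 the first argument is the element k m + r of the system, so this is orthonormality; a
    negative power moves to the other argument because B is unimodular. *)
Lemma inner_blaschkez_takenaka_malmquist (k : int) (r s : nat) : (r < m)%N -> (s < m)%N ->
  inner (fun z => exprz (B z) k * e r z) (e s) = ((k == 0) && (r == s))%:R.
Proof.
move=> rm sm; have key (j r' s' : nat) : (r' < m)%N -> (s' < m)%N ->
    inner (fun z => B z ^+ j * e r' z) (e s') = ((Posz j == 0) && (r' == s'))%:R.
  move=> r'm s'm; transitivity (inner (e (j * m + r')) (e s')).
    by apply: eq_inner => // t; rewrite takenaka_malmquistMD.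
  rewrite (takenaka_malmquist_orthonormal p_lt1); congr (nat_of_bool _)%:R.
  case: j => [|j]; first by rewrite mul0n.
  rewrite /= gtn_eqF // (leq_trans s'm) // mulSn; lia.
case: k => k; first exact: key.
have L1 : L2 (e r) := circle_bounded_L2 (be' r).
have L2' : L2 (fun z => B z ^+ k.+1 * e s z).
  exact/circle_boundedM_L2/circle_bounded_L2/be'/(circle_bounded_blaschkez k.+1).
transitivity (inner (e r) (fun z => B z ^+ k.+1 * e s z)).
  apply: eq_circle_mean => t; rewrite [(_ ^+ _ * _)^*]rmorphM /=.
  rewrite -[B _ ^+ _]/(exprz (B (circle_pt t)) (Posz k.+1)) conj_blaschkez NegzE.
  by ring.
by rewrite (innerC L2') // key // conjC_nat [s == r]eq_sym.
Qed.

Lemma takenaka_malmquist_divmod i z : e i z = B z ^+ (i %/ m) * e (i %% m) z.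
Proof. by rewrite {1}(divn_eq i m) takenaka_malmquistMD. Qed.

Variables (a : int -> C) (phi : C -> C).
Hypotheses (Lphi : L2 phi) (phia : L2_series (fun n z => a n * blaschke lam z ^ n) phi).

Lemma inner_toeplitz_entry (i j : nat) :
  inner (fun z => phi z * e j z) (e i) =
  if (i %% m)%N == (j %% m)%N then a (Posz (i %/ m) - Posz (j %/ m)) else 0.
Proof.
(* Putting both basis functions on one side leaves [phi] alone on the other, so that its [L2]
   expansion applies; h is bounded, hence in [L2]. *)
pose h z := e i z * (e j z)^*.
have bh : circle_bounded h := circle_boundedM (be' i) (circle_bounded_conj (be' j)).
transitivity (inner phi h).
  by apply: eq_circle_mean => t; rewrite /h [(_ * _^*)^*]rmorphM /= conjCK; ring.
apply: (L2_series_inner (N1 := absz (Posz (i %/ m) - Posz (j %/ m))) phia) => //.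
- by move=> k; apply: L2Z; exact/circle_bounded_L2/circle_bounded_blaschkez.
- exact: circle_bounded_L2.
move=> N NN; set d := Posz (i %/ m) - Posz (j %/ m) in NN *.
(* B^k e_j against e_i reduces to B^(k-d) between two of the first m basis functions, so only k = d
   survives, and d is in the window once N >= |d|. *)
transitivity (\sum_(k <- symmetric_window N)
    a k * ((k - d == 0) && (j %% m == i %% m)%N)%:R).
  apply: eq_bigr => k _.
  rewrite -(@inner_blaschkez_takenaka_malmquist _ (j %% m) (i %% m)) ?ltn_pmod //.
  have Lr : L2 (fun z => exprz (B z) (k - d) * e (j %% m) z).
    exact/circle_boundedM_L2/circle_bounded_L2/be'/circle_bounded_blaschkez.
  rewrite -innerZl //; last exact/circle_bounded_L2/be'.
  apply: eq_circle_mean => t; rewrite /h [(_ * _^*)^*]rmorphM /= conjCK.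
  rewrite (takenaka_malmquist_divmod i) (takenaka_malmquist_divmod j).
  rewrite [(_ ^+ _ * _)^*]rmorphM /=.
  rewrite -[B _ ^+ (i %/ m)]/(exprz (B (circle_pt t)) (Posz (i %/ m))) conj_blaschkez.
  rewrite -[B _ ^+ (j %/ m)]/(exprz (B (circle_pt t)) (Posz (j %/ m))).
  have B0 : B (circle_pt t) != 0 by rewrite -normr_eq0 norm_blaschke oner_eq0.
  have -> : k - d = k + - Posz (i %/ m) + Posz (j %/ m) by rewrite /d; lia.
  by rewrite !expfzDr //; ring.
rewrite [(j %% m == _)%N]eq_sym; case: eqP => _; last first.
  by rewrite big1 // => k _; rewrite andbF mulr0.
rewrite (bigD1_seq d) ?uniq_symmetric_window ?mem_symmetric_window //=.
rewrite subrr eqxx mulr1 big1 ?addr0 // => k kd.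
by rewrite subr_eq0 (negPf kd) mulr0.
Qed.

Variable n : nat.
Local Notation K := (model_space (fun z => B z ^+ n)).

Lemma blaschke_power_basis : orthonormal_basis K (fun i : 'I_(n * m) => e i).
Proof.
have -> : (fun z => B z ^+ n) = blaschke_range p 0 (n * m).
  by apply/funext => z; exact: blaschke_power.
exact: takenaka_malmquist_basis.
Qed.

Lemma toeplitz_blaschke_matrix :
  is_operator_matrix K (fun i : 'I_(n * m) => e i) (toeplitz phi K) (block_toeplitz a n m).
Proof.
have H := toeplitz_matrix blaschke_power_basis Lphi (fun i => be' i).
rewrite (_ : block_toeplitz a n m = \matrix_(i, j) inner (fun z => phi z * e j z) (e i)) //.
by apply/matrixP => i j; rewrite !mxE inner_toeplitz_entry.
Qed.

(** The entries are inner products of [phi * e j] with [e i], and a real multiplier moves from one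
    argument to the other. *)
Lemma block_toeplitz_hermitian : ae_circle (fun z => phi z \is Num.real) ->
  (block_toeplitz a n m) ^t* = block_toeplitz a n m.
Proof.
move=> phir; apply/matrixP => i j; rewrite !mxE -!inner_toeplitz_entry.
have Lpe (l : nat) : L2 (fun z => phi z * e l z).
  by apply: eq_L2 (circle_boundedM_L2 (be' l) Lphi) => t; rewrite mulrC.
have Le l : L2 (e l) := circle_bounded_L2 (be' l).
rewrite -(innerC (Lpe i)) //.
have ii := inner_integrable (Lpe j) (Le i).
have mi := circle_integrable_measurable (inner_integrable (Le j) (Lpe i)).
have [|_ H] := ae_circle_mean mi ii; last exact: H.
by apply: ae_circleS phir => t pr; rewrite rmorphM /= (CrealP pr); ring.
Qed.

End BlaschkeToeplitz.

(** * Compactly supported test functions *)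

Section TestFunctions.
Context {R : realType}.
Local Notation C := R[i].

Lemma real_part_ge0 (x : C) : 0 <= x -> exists2 y : R, x = y%:C%C & 0 <= y.
Proof.
move=> x0; have [y xy] : exists y : R, x = y%:C%C.
  by apply/complex_realP; exact: ger0_real.
by exists y => //; rewrite -lecR -xy.
Qed.

Lemma natr_bound (x : C) : 0 <= x -> exists k, forall n, (k <= n)%N -> x <= n%:R.
Proof.
move=> /real_part_ge0[y -> y0]; exists (Num.truncn y).+1 => n kn.
have -> : n%:R = (n%:R : R)%:C%C by rewrite rmorph_nat.
rewrite lecR.
by rewrite (le_trans (ltW (truncnS_gt y))) // ler_nat.
Qed.

Variable G : C^o -> C^o.
Hypotheses (cG : continuous G) (kG : compact (closure [set z : C^o | G z != 0])).

Let supp_closure z : ~ closure [set z : C^o | G z != 0] z -> G z = 0.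
Proof. by move=> H; apply/eqP/negPn/negP => Gz; apply: H; exact: subset_closure. Qed.

Lemma test_function_cvg (x : C^o) (e : C) : 0 < e ->
  exists2 d : C, 0 < d & forall y : C^o, `|x - y| < d -> `|G x - G y| < e.
Proof.
move=> e0; have : \forall y \near x, `|G x - G y| < e.
  by apply: (@cvgr_dist_lt _ C^o _ (nbhs x) _ G (G x)) e0; exact: cG.
by move=> /nbhs_normP[d d0 H]; exists d => // y xy; exact: H.
Qed.

(** Every point has a neighbourhood on which all large n bound |G|; the near-covering form of
    compactness makes n uniform on the closed support, outside which G is 0. *)
Lemma test_function_bounded : exists2 M : C, 0 <= M & forall z, `|G z| <= M.
Proof.
have /compact_near_coveringP H := kG.
have [|N _ HN] := H nat \oo (fun n x => `|G x| <= n%:R).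
  move=> x _; have [d d0 Hd] := test_function_cvg x ltr01.
  have [|k Hk] := @natr_bound (`|G x| + 1); first by rewrite addr_ge0.
  exists (ball x d, [set n | (k <= n)%N]).
    by split; [exact: nbhsx_ballx|exists k].
  move=> [y n] /= [xy kn]; rewrite (le_trans _ (Hk _ kn)) //.
  rewrite -[G y](subrK (G x)) addrC (le_trans (ler_normD _ _)) // lerD2l distrC.
  by rewrite ltW // Hd.
exists N%:R => // z; have [|/supp_closure ->] := pselect (closure [set z : C^o | G z != 0] z).
  by apply: HN => /=.
by rewrite normr0.
Qed.

(** Compactness makes K uniform for one point in the closed support and the other arbitrary. By
    symmetry this leaves only pairs outside the support, where G vanishes. *)
Lemma test_function_modulus (e : C) : 0 < e -> exists2 K : C, 0 <= K &
  forall x y, `|G x - G y| <= e + K * `|x - y| ^+ 2.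
Proof.
move=> e0; have [M M0 GM] := test_function_bounded.
have /compact_near_coveringP H := kG.
have [|N _ HN] := H nat \oo
  (fun n x => forall y, `|G x - G y| <= e + n%:R * `|x - y| ^+ 2).
  move=> x _; have [d d0 Hd] := test_function_cvg x (divr_gt0 e0 (ltr0Sn _ 1)).
  have d20 : 0 < d / 2 by rewrite divr_gt0.
  (* If |x' - y| >= d/2, this k makes k |x' - y|^2 exceed the trivial bound 2 M. Otherwise x' and y
     are both within d of x, and two oscillations of e/2 add up. *)
  have [|k Hk] := @natr_bound ((M + M) / (d / 2) ^+ 2).
    by rewrite divr_ge0 ?addr_ge0 ?exprn_ge0 // ltW.
  exists (ball x (d / 2), [set n | (k <= n)%N]).
    by split; [exact: nbhsx_ballx|exists k].
  move=> [x' n] /= [xx' kn] y; have /real_part_ge0[r rE r0] : 0 <= `|x' - y| by [].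
  have /real_part_ge0[s sE s0] := ltW d20.
  have [rs|sr] := ltP r s.
    rewrite (@le_trans _ _ e) ?lerDl ?mulr_ge0 ?exprn_ge0 //.
    rewrite -(subrKA (G x)) (le_trans (ler_normD _ _)) // [e]splitr.
    rewrite lerD // ltW // ?[`|G x' - _|]distrC Hd //.
      by rewrite (lt_trans xx') // [ltRHS]splitr ltrDl.
    rewrite -(subrKA x') (le_lt_trans (ler_normD _ _)) // [d]splitr ltrD //.
    by rewrite rE sE ltcR.
  apply: (@le_trans _ _ (M + M)); first by rewrite (le_trans (ler_normB _ _)) // lerD.
  have := Hk _ kn; rewrite ler_pdivrMr ?exprn_gt0 // => /le_trans; apply.
  rewrite (@le_trans _ _ (n%:R * `|x' - y| ^+ 2)) ?lerDr ?(ltW e0) //.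
  by rewrite ler_wpM2l // lerXn2r ?nnegrE ?(ltW d20) // sE rE lecR.
exists N%:R => // x y.
have [|xS] := pselect (closure [set z : C^o | G z != 0] x);
  first by move=> xS; exact: (HN N (leqnn N) x xS y).
have [yS|yS] := pselect (closure [set z : C^o | G z != 0] y).
  by rewrite distrC [`|x - y|]distrC; exact: (HN N (leqnn N) y yS x).
by rewrite (supp_closure xS) (supp_closure yS) subrr normr0 addr_ge0 ?(ltW e0) ?mulr_ge0 ?exprn_ge0.
Qed.

Lemma test_function_circle_bounded f : circle_measurable f -> circle_bounded (fun z => G (f z)).
Proof.
move=> mf; have [M _ GM] := test_function_bounded.
by split; [exact: circle_measurable_comp|exists M => t; exact: GM].
Qed.

End TestFunctions.

(** * The limit of the spectral means *)

Section Distribution.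
Local Open Scope sesquilinear_scope.
Context {R : realType}.
Local Notation C := R[i].
Variables (m : nat) (hm : (0 < m)%N) (lam : 'I_m -> C).
Hypothesis hlam : forall i, `|lam i| < 1.
Local Notation K n := (model_space (fun z => blaschke lam z ^+ n)).
Variables (a : int -> C) (varphi : C -> C).
Hypotheses (Lvarphi : L2 varphi) (varphia : L2_series (fun n z => a n * z ^ n) varphi).

Let defect n z : C := \sum_(k < n) `|varphi z - laurent_sum a (toeplitz_window n k) z| ^+ 2.

Lemma circle_mean_defect n : circle_integrable (defect n) /\
  circle_mean (defect n) = \sum_(k < n) inner
    (fun z => varphi z - laurent_sum a (toeplitz_window n k) z)
    (fun z => varphi z - laurent_sum a (toeplitz_window n k) z).
Proof.
have L k : L2 (fun z => varphi z - laurent_sum a (toeplitz_window n k) z).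
  by apply: L2B => //; exact: L2_laurent_sum.
have [h1 h2] := @circle_mean_sum _ _ (index_enum 'I_n) predT _
  (fun k _ _ => inner_integrable (L k) (L k)).
have E t : \sum_(k < n) (varphi (circle_pt t) - laurent_sum a (toeplitz_window n k) (circle_pt t)) *
    (varphi (circle_pt t) - laurent_sum a (toeplitz_window n k) (circle_pt t))^* =
    defect n (circle_pt t) by apply: eq_bigr => k _; rewrite normCK.
split; first exact: eq_circle_integrable E h1.
by rewrite -h2; apply: eq_circle_mean => t; rewrite E.
Qed.

(** The common end of both cases: f is [varphi] for eigenvalues and its modulus for singular values,
    and c is the loss in passing from the defect of the trial vectors to the spread of the
    spectrum. *)
Lemma distributed_of_defect (sv : nat -> seq C) f (c : C) : 0 <= c -> L2 f ->
  (forall n, (0 < n)%N -> exists (P : 'M[C]_(n * m)) (d : 'I_(n * m) -> C),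
    [/\ P \is unitarymx, perm_eq (sv n) [seq d i | i : 'I_(n * m)] &
        forall r t, \sum_i `|d i - f (circle_pt t)| ^+ 2 *
          `|(P *m trial_vector n r (circle_pt t)) i 0| ^+ 2 <= c * defect n (circle_pt t)]) ->
  distributed (fun n => K n) sv f.
Proof.
move=> c0 Lf H G cG kG.
apply: (fun u => (cvgrPdist_le (F := \oo) _ _).2 u) => eps e0.
have [k k0 Gk] := test_function_modulus cG kG (divr_gt0 e0 (ltr0Sn _ 1)).
have kc1 : 0 < k * c + 1 by rewrite ltr_pwDr ?mulr_ge0.
(* The mean defect will be multiplied by k c, which may be 0; the added 1 keeps the quotient
   meaningful. *)
have e'0 : 0 < eps / 2 / (k * c + 1) by rewrite !divr_gt0.
have [n0 Hn0] := toeplitz_defect_small Lvarphi varphia e'0.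
exists (maxn n0 1) => // n /=; rewrite geq_max => /andP[n0n n1].
have [P [d [uP sd dB]]] := H n n1.
rewrite (subspace_dimE (blaschke_power_basis hm hlam n)).
(* The list has exactly n m entries, so the default value of [nth] is never reached, and the sum is
   insensitive to the order. *)
have -> : \sum_(i < n * m) G (sv n)`_i = \sum_(i < n * m) G (d i).
  have sz : size (sv n) = (n * m)%N by rewrite (perm_size sd) size_map -cardE card_ord.
  transitivity (\sum_(0 <= i < size (sv n)) G (sv n)`_i); first by rewrite sz big_mkord.
  by rewrite -(big_nth 0 xpredT G) (perm_big _ sd) /= big_map enumT.
have [iB mB] := circle_mean_defect n.
have [icB mcB] := (circle_integrableZ c iB, circle_meanZ c iB).
have Gf := test_function_circle_bounded cG kG (L2_measurable Lf).
have := averaging_bound n1 hm uP k0 Lf Gf Gk (fun=> icB) dB.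
rewrite distrC => /le_trans; apply.
rewrite [leRHS]splitr lerD2l sumr_const card_ord mcB mB.
move: (Hn0 n n0n n1); set SS := (X in n%:R^-1 * X) => Sn.
have -> : k * (n * m)%:R^-1 * ((c * SS) *+ m) = k * c * (n%:R^-1 * SS).
  have m0 : m%:R != 0 :> C by rewrite pnatr_eq0 -lt0n.
  have nn0 : n%:R != 0 :> C by rewrite pnatr_eq0 -lt0n.
  rewrite -[_ *+ m]mulr_natr natrM; clearbody SS.
  by move: (m%:R) (n%:R) m0 nn0 => m' n' m0 nn0; field; rewrite m0 nn0.
rewrite (le_trans (ler_wpM2l _ Sn)) ?mulr_ge0 // mulrA ler_pdivrMr // mulrC.
by rewrite ler_wpM2l ?lerDl // ltW // divr_gt0.
Qed.

Lemma L2_norm (f : C -> C) : L2 f -> L2 (fun z => `|f z|).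
Proof.
move=> Lf; have /L2P[mf ff] := Lf; apply/L2P; split.
  apply: (circle_measurable_comp mf (G := fun z : C^o => (`|z| : C^o))).
  by move=> z; exact: norm_continuous.
by apply: eq_circle_integrable ff => t; rewrite conj_normC -normCK expr2.
Qed.

Variables (phi : C -> C).
Hypotheses (Lphi : L2 phi) (phia : L2_series (fun n z => a n * blaschke lam z ^ n) phi).

Lemma toeplitz_singular_values :
  distributed_singular_values phi (fun n => K n) (fun z => `|varphi z|).
Proof.
(* 4 is the factor 2 of [singular_defect] times the two equal defects of A and A^*. *)
apply: (@distributed_of_defect _ _ 4) => //; first exact: L2_norm.
move=> n n0; set A := block_toeplitz a n m.
have [P [s [uP s0 PA chi]]] := gram_spectral A.
have be := blaschke_power_basis hm hlam n.
have TA := @toeplitz_blaschke_matrix _ _ hm _ hlam _ _ Lphi phia n.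
have TT := @comp_matrix _ _ _ _ _ _ _ _ (@adjoint_matrix _ _ _ _ be _ _ TA) TA.
exists P, s; split => // [|r t].
  rewrite /singular_values.
  have : perm_eq (eigenvalues (K n) (adjoint (K n) (toeplitz phi (K n)) \o toeplitz phi (K n)))
      [seq s i ^+ 2 | i : 'I_(n * m)].
    apply: (eigenvalues_perm be TT).
    by rewrite chi big_map enumT.
  move/(perm_map sqrtC); rewrite -map_comp.
  rewrite (eq_map (_ : _ =1 s)) // => i /=; rewrite expr2 -expr2 sqrCK //.
apply: le_trans (singular_defect _ _ uP s0 PA) _.
rewrite block_toeplitz_adj !block_toeplitz_defect // toeplitz_window_rev.
rewrite -/(defect n _); move: (defect n _) => x.
by have -> : 2 * (x + x) = 4 * x by ring.
Qed.

Lemma toeplitz_eigenvalues : ae_circle (fun z => phi z \is Num.real) ->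
  distributed_eigenvalues phi (fun n => K n) varphi.
Proof.
move=> phir; apply: (@distributed_of_defect _ _ 1) => // n n0.
have be := blaschke_power_basis hm hlam n.
have TA := @toeplitz_blaschke_matrix _ _ hm _ hlam _ _ Lphi phia n.
have [P [d [uP PA _ chi]]] := hermitian_spectral (block_toeplitz_hermitian hm hlam Lphi phia n phir).
exists P, d; split => // [|r t].
  by apply: (eigenvalues_perm be TA); rewrite chi big_map enumT.
by rewrite (hermitian_defect _ _ uP PA) block_toeplitz_defect // mul1r.
Qed.

End Distribution.

Theorem theorem13 (R : realType) (m : nat) (hm : (0 < m)%N)
  (lam : 'I_m -> R[i]) (hlam : forall i, `|lam i| < 1)
  (phi : R[i] -> R[i]) (hphi : M1 (blaschke lam) phi)
  (a : int -> R[i])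
  (ha : (\esum_(n in [set: int]) ((complex.Re `|a n| ^+ 2)%:E) < +oo)%E)
  (hphia : L2_series (fun n z => a n * blaschke lam z ^ n) phi)
  (varphi : R[i] -> R[i]) (hvarphi : L2 varphi)
  (hvarphia : L2_series (fun n z => a n * z ^ n) varphi) :
  distributed_singular_values phi
    (fun n => model_space (fun z => blaschke lam z ^+ n))
    (fun z => `|varphi z|)
  /\
  (ae_circle (fun z => phi z \is Num.real) ->
   distributed_eigenvalues phi
    (fun n => model_space (fun z => blaschke lam z ^+ n))
    varphi).
Proof.
have [Lphi _] := hphi; split.
  exact: (toeplitz_singular_values hm hlam hvarphi hvarphia Lphi hphia).
exact: (toeplitz_eigenvalues hm hlam hvarphi hvarphia Lphi hphia).
Qed.
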